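(* Let $\Gamma$ be a countable group and $(X,\mu)$ a Lebesgue probability space. Suppose that $\Gamma$ either has property MD or has the form $\Gamma=G\times H$ where $H$ is an infinite amenable residually finite group. Then the subset of all actions $\mathbf{a}\in A(\Gamma,X,\mu)$ with zero naive entropy is residual in the sense of Baire category, i.e. it contains a dense $G_\delta$ subset of $A(\Gamma,X,\mu)$.
   Context: $\mathrm{Aut}(X,\mu)$ is the group of measure-preserving automorphisms of $(X,\mu)$, with automorphisms agreeing almost everywhere identified, with the Polish topology in which $T_i\to T$ iff $\mu(T_iA\vartriangle TA)\to 0$ for every measurable $A\subset X$. $A(\Gamma,X,\mu)$ is the space of all homomorphisms $\mathbf{a}:\Gamma\to \mathrm{Aut}(X,\mu)$ with the topology of pointwise convergence. Property MD. The profinite completion of $\Gamma$ is the inverse limit of the groups $\Gamma/N$ with $N$ a finite-index normal subgroup; $\Gamma$ acts on it by left translations preserving Haar measure, and this action is denoted $p_\Gamma$. Let $\iota$ be the trivial action of $\Gamma$ on the unit interval with Lebesgue measure. $\Gamma$ has MD if the measure-conjugacy class of the direct product action $p_\Gamma\times\iota$ is dense in $A(\Gamma,X,\mu)$. Equivalently: the set of finitely supported measures is dense (weak* ) in the space $\mathrm{Prob}_\Gamma(\mathbf{Cantor}^\Gamma)$ of $\Gamma$-invariant Borel probability measures on $\mathbf{Cantor}^\Gamma$, where $\mathbf{Cantor}$ is the Cantor set and $(gx)(f)=x(g^{-1}f)$. A group is residually finite if for every non-identity element $g$ there is a finite-index subgroup not containing $g$. Naive entropy. Partitions are measurable, $H_\mu(\mathcal{P})=-\sum_{P\in\mathcal{P}}\mu(P)\log\mu(P)$,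 and for finite $W\subset\Gamma$, $\mathcal{P}^W=\bigvee_{w\in W}w^{-1}\mathcal{P}$. Set $h^{naive}_\mu(\mathcal{P})=\inf_W |W|^{-1}H_\mu(\mathcal{P}^W)$, the infimum over (nonempty) finite $W\subset\Gamma$. The naive entropy of $\Gamma\curvearrowright(X,\mu)$ is $h^{naive}_\Gamma(X,\mu)=\sup_{\mathcal{P}}h^{naive}_\mu(\mathcal{P})$ over all partitions $\mathcal{P}$ with $H_\mu(\mathcal{P})<\infty$.
   Formalization: ''Countable group'' is taken to mean countably infinite: for finite groups (e.g. the trivial group, which has MD) every action on a non-atomic Lebesgue space has infinite naive entropy, so the claim fails there. *)

(* Defs.v *)
From HB Require Import structures.
From mathcomp Require Import all_boot all_order all_algebra finmap.
From mathcomp Require Import generic_quotient.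
From mathcomp Require Import all_classical all_reals all_analysis.

Set Implicit Arguments.
Unset Strict Implicit.
Unset Printing Implicit Defensive.

Import Order.TTheory GRing.Theory Num.Theory.
Import numFieldNormedType.Exports.

Local Open Scope classical_set_scope.
Local Open Scope ring_scope.
Local Open Scope quotient_scope.

Section Groups.
Context {G : groupType}.
Local Open Scope group_scope.

Definition lcoset_of (N : set G) (g : G) : set G := [set g * n | n in N].

Definition finite_index (N : set G) : Prop :=
  finite_set (range (lcoset_of N)).

Definition normalized (N : set G) : Prop :=
  forall g n, N n -> N (g * n * g^-1).

Definition residually_finite : Prop :=
  forall g : G, g != 1 ->
    exists N : set G, [/\ group_closed (mem N), finite_index N & ~ N g].

(* Foelner's condition, with tolerance [1 / n]. *)
Definition amenable : Prop :=
  forall (K : {fset G}) (n : nat),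
    exists2 F : {fset G}, F != fset0 &
      forall k, k \in K ->
        let kF := [fset (k * f)%g | f in F]%fset in
        (n * #|` ((kF `\` F) `|` (F `\` kF))%fset| <= #|` F|)%N.

End Groups.
Arguments residually_finite : clear implicits.
Arguments amenable : clear implicits.

Section Automorphisms.
Context d (X : measurableType d) (R : realType) (mu : probability X R).

(* Every almost everywhere invertible measure-preserving map agrees almost
   everywhere with such an everywhere bijective one. *)
Record mp_bij := MpBij {
  mp_fun :> X -> X ;
  mp_inv : X -> X ;
  mp_funK : cancel mp_fun mp_inv ;
  mp_invK : cancel mp_inv mp_fun ;
  mp_fun_measurable : measurable_fun setT mp_fun ;
  mp_inv_measurable : measurable_fun setT mp_inv ;
  mp_fun_mp : forall A, measurable A -> mu (mp_fun @^-1` A) = mu A }.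

HB.instance Definition _ := gen_eqMixin mp_bij.
HB.instance Definition _ := gen_choiceMixin mp_bij.

Definition mp_ae_eq (S T : mp_bij) : bool := `[< \forall x \ae mu, S x = T x >].

Lemma mp_ae_eq_refl : reflexive mp_ae_eq.
Proof. by move=> S; apply/asboolP; exact: aeW. Qed.

Lemma mp_ae_eq_sym : symmetric mp_ae_eq.
Proof.
by move=> S T; apply/asboolP/asboolP; apply: filterS => x ->.
Qed.

Lemma mp_ae_eq_trans : transitive mp_ae_eq.
Proof.
move=> T S U /asboolP ST /asboolP TU; apply/asboolP.
by apply: filterS2 ST TU => x -> ->.
Qed.

Definition mp_equiv : equiv_rel mp_bij :=
  EquivRel mp_ae_eq mp_ae_eq_refl mp_ae_eq_sym mp_ae_eq_trans.

Definition Aut := {eq_quot mp_equiv}.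
HB.instance Definition _ := Choice.on Aut.
HB.instance Definition _ := Quotient.on Aut.
HB.instance Definition _ := EqQuotient.on Aut.

Definition Aut_fun (T : Aut) : X -> X := (repr T : mp_bij).

Lemma Aut_eqP (S T : mp_bij) :
  \pi_Aut S = \pi_Aut T <-> \forall x \ae mu, S x = T x.
Proof.
split=> [/eqmodP/asboolP //|ST].
by apply/eqmodP/asboolP.
Qed.

Lemma Aut_fun_pi (S : mp_bij) : \forall x \ae mu, Aut_fun (\pi_Aut S) x = S x.
Proof. by apply/Aut_eqP; rewrite reprK. Qed.

Lemma Aut_ext (S T : Aut) :
  (\forall x \ae mu, Aut_fun S x = Aut_fun T x) -> S = T.
Proof. by move=> /Aut_eqP; rewrite !reprK. Qed.

Lemma ae_mp_preimage (S : mp_bij) (P : set X) :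
  (\forall x \ae mu, P x) -> \forall x \ae mu, P (S x).
Proof.
move=> [N [mN N0 PN]]; exists (S @^-1` N); split.
- by rewrite -[_ @^-1` _]setTI; exact: mp_fun_measurable.
- by rewrite mp_fun_mp.
- by move=> x /= nP; exact: PN.
Qed.

Lemma mp_bij_one_mp A : measurable A -> mu (id @^-1` A) = mu A.
Proof. by []. Qed.

Definition mp_bij_one : mp_bij :=
  @MpBij id id (fun=> erefl) (fun=> erefl)
    (@measurable_id _ X setT) (@measurable_id _ X setT) mp_bij_one_mp.

Section mul.
Variables S T : mp_bij.

Let mulmp A : measurable A -> mu ((S \o T) @^-1` A) = mu A.
Proof.
move=> mA; rewrite comp_preimage mp_fun_mp ?mp_fun_mp//.
by rewrite -[_ @^-1` _]setTI; exact: mp_fun_measurable.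
Qed.

Definition mp_bij_mul : mp_bij :=
  @MpBij (S \o T) (mp_inv T \o mp_inv S)
    (can_comp (mp_funK S) (mp_funK T)) (can_comp (mp_invK T) (mp_invK S))
    (measurableT_comp (mp_fun_measurable S) (mp_fun_measurable T))
    (measurableT_comp (mp_inv_measurable T) (mp_inv_measurable S)) mulmp.
End mul.

Section inv.
Variable S : mp_bij.

Let invmp A : measurable A -> mu (mp_inv S @^-1` A) = mu A.
Proof.
move=> mA; rewrite -(mp_fun_mp S); last first.
  by rewrite -[_ @^-1` _]setTI; exact: mp_inv_measurable.
by congr (mu _); apply/seteqP; split => x /=; rewrite mp_funK.
Qed.

Definition mp_bij_inv : mp_bij :=
  @MpBij (mp_inv S) S (mp_invK S) (mp_funK S)
    (mp_inv_measurable S) (mp_fun_measurable S) invmp.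
End inv.

Definition Aut_one : Aut := \pi_Aut mp_bij_one.
Definition Aut_mul (S T : Aut) : Aut := \pi_Aut (mp_bij_mul (repr S) (repr T)).
Definition Aut_inv (S : Aut) : Aut := \pi_Aut (mp_bij_inv (repr S)).

Lemma Aut_fun_one : \forall x \ae mu, Aut_fun Aut_one x = x.
Proof. exact: Aut_fun_pi. Qed.

Lemma Aut_fun_mul (S T : Aut) :
  \forall x \ae mu, Aut_fun (Aut_mul S T) x = Aut_fun S (Aut_fun T x).
Proof. exact: Aut_fun_pi. Qed.

Lemma Aut_mulA : associative Aut_mul.
Proof.
move=> S T U; apply: Aut_ext.
have STU := ae_mp_preimage (repr U) (Aut_fun_mul S T).
apply: filterS3 (Aut_fun_mul S (Aut_mul T U)) (Aut_fun_mul T U)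
  (filterI (Aut_fun_mul (Aut_mul S T) U) STU) => x -> -> [-> +].
by rewrite -/(Aut_fun U x) => ->.
Qed.

Lemma Aut_mul1g : left_id Aut_one Aut_mul.
Proof.
move=> S; apply: Aut_ext.
have := ae_mp_preimage (repr S) Aut_fun_one.
by apply: filterS2 (Aut_fun_mul Aut_one S) => x ->.
Qed.

Lemma Aut_mulg1 : right_id Aut_one Aut_mul.
Proof.
move=> S; apply: Aut_ext.
by apply: filterS2 (Aut_fun_mul S Aut_one) Aut_fun_one => x -> ->.
Qed.

Lemma Aut_mulVg : left_inverse Aut_one Aut_inv Aut_mul.
Proof.
move=> S; apply: Aut_ext.
have := ae_mp_preimage (repr S) (Aut_fun_pi (mp_bij_inv (repr S))).
apply: filterS3 (Aut_fun_mul (Aut_inv S) S) Aut_fun_one => x -> ->.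
by rewrite /= -/(Aut_fun S x) => ->; rewrite mp_funK.
Qed.

Lemma Aut_mulgV : right_inverse Aut_one Aut_inv Aut_mul.
Proof.
move=> S; apply: Aut_ext.
have := Aut_fun_pi (mp_bij_inv (repr S)).
apply: filterS3 (Aut_fun_mul S (Aut_inv S)) Aut_fun_one => x -> -> ->.
by rewrite /Aut_fun /= mp_invK.
Qed.

HB.instance Definition _ :=
  isGroup.Build Aut Aut_mulA Aut_mul1g Aut_mulg1 Aut_mulVg Aut_mulgV.

Definition Aut_dist (A : set X) (S T : Aut) : \bar R :=
  mu ((Aut_fun S @` A) `+` (Aut_fun T @` A)).

Definition Aut_subbase : set (set Aut) :=
  [set U | exists T A (e : R), [/\ measurable A, 0 < e &
     U = [set S | (Aut_dist A S T < e%:E)%E]]].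

HB.instance Definition _ :=
  isSubBaseTopological.Build Aut Aut_subbase id.

Lemma Aut_fun_image (S : Aut) A : Aut_fun S @` A = mp_inv (repr S) @^-1` A.
Proof.
apply/seteqP; split=> [_ [x Ax <-] /=|x /= Ax]; first by rewrite /Aut_fun mp_funK.
by exists (mp_inv (repr S) x) => //; rewrite /Aut_fun mp_invK.
Qed.

Lemma Aut_fun_image_measurable (S : Aut) A :
  measurable A -> measurable (Aut_fun S @` A).
Proof.
move=> mA; rewrite Aut_fun_image -[_ @^-1` _]setTI.
exact: mp_inv_measurable.
Qed.

Lemma Aut_dist_triangle (A : set X) (S T U : Aut) : measurable A ->
  (Aut_dist A S U <= Aut_dist A S T + Aut_dist A T U)%E.
Proof.
move=> mA; rewrite /Aut_dist.
have [mS mT mU] : [/\ measurable (Aut_fun S @` A), measurable (Aut_fun T @` A)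
  & measurable (Aut_fun U @` A)] by split; exact: Aut_fun_image_measurable.
apply: (le_trans _ (measureU2 _ _ _)).
- apply: le_measure; rewrite ?inE.
  + by apply: measurableU; apply: measurableD.
  + by apply: measurableU; apply: measurableU; apply: measurableD.
  + rewrite /setY => x [[Sx Ux]|[Ux Sx]];
      have [Tx|Tx] := pselect ((Aut_fun T @` A) x).
    * by right; left.
    * by left; left.
    * by left; right.
    * by right; right.
- by apply: measurableU; apply: measurableD.
- by apply: measurableU; apply: measurableD.
Qed.

Lemma Aut_dist_fin (A : set X) (S T : Aut) : measurable A ->
  Aut_dist A S T \is a fin_num.
Proof.
move=> mA; apply: fin_num_measure.
by apply: measurableU; apply: measurableD; exact: Aut_fun_image_measurable.
Qed.

Lemma Aut_distC (A : set X) (S T : Aut) : Aut_dist A S T = Aut_dist A T S.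
Proof. by rewrite /Aut_dist setYC. Qed.

Lemma Aut_distxx (A : set X) (S : Aut) : Aut_dist A S S = 0%E.
Proof. by rewrite /Aut_dist setYK measure0. Qed.

Lemma Aut_cvgP (F : set_system Aut) (T : Aut) : Filter F ->
  F --> T <-> (forall (A : set X) (e : R), measurable A -> 0 < e ->
    \forall S \near F, (Aut_dist A S T < e%:E)%E).
Proof.
move=> FF; split=> [FT A e mA e0|FT V].
  apply: FT; rewrite nbhsE; exists [set S | (Aut_dist A S T < e%:E)%E] => //.
  split; last by rewrite /= Aut_distxx lte_fin.
  pose U := [set S | (Aut_dist A S T < e%:E)%E].
  exists [set U]; last by rewrite bigcup_set1.
  move=> _ ->; exists [fset U]%fset.
    by move=> W /fset1P ->; apply/mem_set; exists T, A, e.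
  by rewrite set_fset1 bigcap_set1.
rewrite nbhsE; case=> O [[B BI <-] [W BW WT]] OV.
apply: filterS OV _.
apply: (@filterS _ F _ W) => [S WS|]; first by exists W.
have [D' D'sub WE] := BI _ BW.
rewrite -WE; apply: filter_bigI => U /[dup] /D'sub.
rewrite inE; case=> T0 [A [e [mA e0 ->]]] UD'.
have T0e : (Aut_dist A T T0 < e%:E)%E.
  by have := WT; rewrite -WE => /(_ _ UD').
have e'0 : 0 < e - fine (Aut_dist A T T0).
  by rewrite subr_gt0 -lte_fin fineK// Aut_dist_fin.
apply: filterS (FT A _ mA e'0) => S /= ST.
apply: (le_lt_trans (Aut_dist_triangle S T T0 mA)).
by rewrite -[X in (_ + X)%E]fineK ?Aut_dist_fin// -lteBrDr.
Qed.

End Automorphisms.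

Section Actions.
Context (G : groupType) d (X : measurableType d) (R : realType)
  (mu : probability X R).

Definition actions := {multiplicative G -> Aut mu}.

(* A representative of the class [a g] of maps agreeing almost everywhere. *)
Definition act (a : actions) (g : G) : X -> X :=
  Aut_fun ((a : Multiplicative.type _ _) g).

HB.instance Definition _ := gen_eqMixin actions.
HB.instance Definition _ := gen_choiceMixin actions.

Definition actions_ptws (a : actions) : {ptws G -> Aut mu} :=
  (a : Multiplicative.type _ _).

HB.instance Definition _ :=
  Topological.copy actions (initial_topology actions_ptws).

End Actions.

Section NaiveEntropy.
Context (G : groupType) d (X : measurableType d) (R : realType)
  (mu : probability X R).

Definition measurable_partition (P : set (set X)) : Prop :=
  [/\ countable P, (forall A, P A -> measurable A) & partition P id [set: X]].

Definition entropy (P : set (set X)) : \bar R :=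
  \esum_(A in P) (- (fine (mu A) * ln (fine (mu A))))%:E.

(* The common refinement of the [(act a w) @^-1` P] for [w \in W]; it may also
   contain [set0], which does not contribute to the entropy. *)
Definition refinement (a : actions G mu) (P : set (set X)) (W : {fset G}) :
    set (set X) :=
  [set \bigcap_(w in [set` W]) (act a w @^-1` A w) |
     A in [set A : G -> set X | forall w, w \in W -> P (A w)]].

Definition naive_entropy_of (a : actions G mu) (P : set (set X)) : \bar R :=
  ereal_inf [set ((#|` W|%:R)^-1%:E * entropy (refinement a P W))%E |
    W in [set W : {fset G} | W != fset0]].

Definition naive_entropy (a : actions G mu) : \bar R :=
  ereal_sup [set naive_entropy_of a P |
    P in [set P | measurable_partition P /\ (entropy P < +oo)%E]].

End NaiveEntropy.

Section Isomorphisms.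
Context d d' (X : measurableType d) (Y : measurableType d') (R : realType).

(* Isomorphism modulo null sets; [g] is then measure-preserving as well. *)
Definition measure_iso (mu : {measure set X -> \bar R})
    (nu : {measure set Y -> \bar R}) (f : X -> Y) : Prop :=
  [/\ measurable_fun setT f,
      (forall B, measurable B -> nu B = mu (f @^-1` B)) &
      exists g : Y -> X, [/\ measurable_fun setT g,
        (\forall x \ae mu, g (f x) = x) & (\forall y \ae nu, f (g y) = y)]].

Definition measure_conjugate (G : groupType) (mu : probability X R)
    (a : actions G mu) (nu : {measure set Y -> \bar R}) (b : G -> Y -> Y) :
    Prop :=
  exists2 f : X -> Y, measure_iso mu nu f &
    forall g : G, \forall x \ae mu, f (act a g x) = b g (f x).

End Isomorphisms.

Section UnitInterval.
Context (R : realType).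

(* Lebesgue measure on the unit interval, as a measure on the line
   concentrated on [0, 1]. *)
Definition unit_lebesgue : set (measurableTypeR R) -> \bar R :=
  mrestr lebesgue_measure (measurable_itv `[0%R, 1%R]).

HB.instance Definition _ := Measure.on unit_lebesgue.

Lemma unit_lebesgue_setT : unit_lebesgue setT = 1%E.
Proof.
by rewrite /unit_lebesgue /mrestr setTI lebesgue_measure_itv /= lte01 oppr0 adde0.
Qed.

HB.instance Definition _ :=
  Measure_isProbability.Build _ _ R unit_lebesgue unit_lebesgue_setT.

End UnitInterval.
Arguments unit_lebesgue : clear implicits.

Definition lebesgue_space d (X : measurableType d) (R : realType)
    (mu : probability X R) : Prop :=
  exists f, measure_iso mu (unit_lebesgue R) f.

Section Profinite.
Context (G : groupType).
Local Open Scope group_scope.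

Record fin_normal := FinNormal {
  fin_normal_set :> set G ;
  fin_normal_group : group_closed (mem fin_normal_set) ;
  fin_normal_normal : normalized fin_normal_set ;
  fin_normal_index : finite_index fin_normal_set }.

(* An element of the inverse limit is a family of cosets, [x N] being an
   element of [G / N]; the image of a coset of [N] under [G / N -> G / M] is
   the coset of [M] that contains it. *)
Record profinite := Profinite {
  prof_fun :> fin_normal -> set G ;
  prof_coset : forall N, exists g, prof_fun N = lcoset_of N g ;
  prof_compat : forall N M : fin_normal, N `<=` M -> prof_fun N `<=` prof_fun M
}.

Lemma lcoset_of_mul (N : fin_normal) (g h : G) :
  [set u * v | u in lcoset_of N g & v in lcoset_of N h] = lcoset_of N (g * h).
Proof.
have [N1 NB] := fin_normal_group N.
have NV n : (N : set G) n -> (N : set G) n^-1.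
  move=> Nn; have /set_mem := NB 1 n N1 (mem_set Nn).
  by rewrite div1g.
have NM m n : (N : set G) m -> (N : set G) n -> (N : set G) (m * n).
  move=> Nm /NV Nn; have /set_mem := NB m n^-1 (mem_set Nm) (mem_set Nn).
  by rewrite invgK.
apply/seteqP; split.
  move=> _ [_ [m Nm <-]] [_ [n Nn <-]] <-.
  exists (h^-1 * m * h * n).
    apply: NM => //; rewrite -{2}[h]invgK.
    exact: (@fin_normal_normal N).
  by rewrite !mulgA mulgK.
move=> _ [n Nn <-]; exists g; first by exists 1; [exact: set_mem|rewrite mulg1].
by exists (h * n); [exists n|rewrite mulgA].
Qed.

Definition prof_one : profinite.
Proof.
by exists (fun N => lcoset_of N 1) => [N|N M NM _ [n Nn <-]];
  [exists 1 | exists n => //; exact: NM].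
Defined.

Definition prof_mul (x y : profinite) : profinite.
Proof.
exists (fun N => [set u * v | u in x N & v in y N]).
- move=> N; have [g ->] := prof_coset x N; have [h ->] := prof_coset y N.
  by exists (g * h); exact: lcoset_of_mul.
- move=> N M NM _ [u xu] [v yv] <-.
  by exists u; [exact: (prof_compat NM)|exists v => //; exact: (prof_compat NM)].
Defined.

Definition prof_inj (g : G) : profinite.
Proof.
by exists (fun N => lcoset_of N g) => [N|N M NM _ [n Nn <-]];
  [exists g | exists n => //; exact: NM].
Defined.

HB.instance Definition _ := gen_eqMixin profinite.
HB.instance Definition _ := gen_choiceMixin profinite.
HB.instance Definition _ := isPointed.Build profinite (prof_inj 1).

(* The topology induced by the product of the finite discrete [G / N]. *)
Definition prof_subbase : set (set profinite) :=
  [set U | exists N C, U = [set x : profinite | x N = C]].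

HB.instance Definition _ :=
  isSubBaseTopological.Build profinite prof_subbase id.

Definition prof_borel := g_sigma_algebraType (@open profinite).

Definition is_haar (R : realType) (eta : probability prof_borel R) : Prop :=
  forall (y : profinite) (A : set prof_borel), measurable A ->
    eta (prof_mul y @` A) = eta A.

End Profinite.

Section MD.
Context (G : groupType) d (X : measurableType d) (R : realType)
  (mu : probability X R).

(* The action p_G x iota. *)
Definition prof_act (g : G) (z : prof_borel G * measurableTypeR R) :
    prof_borel G * measurableTypeR R :=
  (prof_mul (prof_inj g) z.1, z.2).

(* Meaningful when [mu] is a Lebesgue space; it then does not depend on [mu]. *)
Definition property_MD : Prop :=
  exists2 eta : probability (prof_borel G) R, is_haar eta &
    dense [set a : actions G mu |
      measure_conjugate a (eta \x unit_lebesgue R)%E prof_act].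

End MD.

(* Main.v *)
(* Call an action recurrent if its elements return infinitely often to every
   neighbourhood of the identity of Aut(X, mu).  Since that group is second
   countable, recurrent actions form a G_delta set.

   Recurrent actions have zero naive entropy: if [W] consists of [k] elements
   moving each cell of P very little, then each step adds at most [eps] to the
   entropy of the refinement, so that H(P^W) / k <= H(P) / k + eps.

   They are dense.  Under MD it suffices that p_Gamma x iota is recurrent, which
   holds because a finite-index normal subgroup fixes the cylinders of its
   cosets.  When Gamma = G x H, a residually finite H has finite quotients Y in
   which a given Foelner set injects, and a random greedy choice of translates
   of that set yields s : Y -> H with s (h y) = h s (y) for most y.  On X x Y,
   the formula (g, h) (x, y) = (a (g, s (h y) s (y)^-1) x, h y) defines an action
   in which infinitely many elements of H act trivially and (g, h) acts on most
   of each fibre as a (g, h) does.  Identifying X x Y with X by a map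
   whose first coordinate is nearly the identity gives actions on X that
   converge to [a]. *)
Require Import Defs.
From HB Require Import structures.
From mathcomp Require Import all_boot all_order all_algebra finmap.
From mathcomp Require Import generic_quotient perm ring lra.
From mathcomp Require Import all_classical all_reals all_analysis.
From mathcomp Require Import borel_hierarchy measurable_realfun.

Set Implicit Arguments.
Unset Strict Implicit.
Unset Printing Implicit Defensive.

Local Open Scope classical_set_scope.

(** * Almost equivariant maps from finite sets to amenable groups *)

(** A partition of finite entropy may have infinitely many cells, while recurrence controls finitely
    many sets at a time. The remaining cells are paid for by the tail of a series that converges
    because the entropy is finite.

    A [G_delta] set is cut out by countably many open conditions, so recurrence is tested on one
    sequence of measurable sets that approximates all the others; the rational half-lines supply it.

    A countable group can have uncountably many finite-index normal subgroups, and then the Borel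
    sets of its completion are out of reach of countably many cylinders. An action conjugate to
    p_Gamma x iota lives on a separable space, however, and this forces the subgroups to be
    countable in number.

    In the product case [s (h y) s (y)^-1] satisfies the cocycle identity for every map [s], and the
    factor [G] commutes with it, so an action results whatever [s] is. The near equivariance of [s]
    serves only to make this action close to [a]. The elements of [H] that fix [Y] pointwise are
    infinitely many since [Y] is finite, and on them the cocycle is trivial. *)

Section RandomOrder.
Context (T : finType).
Implicit Types (B C : {set T}) (b : T).

(** A uniformly random order of [T] is modelled by a permutation [q] ranking [c] by
    [enum_rank (q c)], so that probabilities become numbers of permutations. *)
Definition first_at B b : {set {perm T}} :=
  [set q : {perm T} | (b \in B) &&
     [forall c in B, (enum_rank (q b) <= enum_rank (q c))%N]]%SET.

(** Exchanging [b] and [c] injects the orders in which [b] comes first into those in which [c]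
    does. *)
Lemma first_at_le B b c : b \in B -> c \in B ->
  (#|first_at B b| <= #|first_at B c|)%N.
Proof.
move=> bB cB; pose f (q : {perm T}) := (tperm b c * q)%g.
have finj : injective f by exact: mulgI.
rewrite -(card_imset _ finj); apply: subset_leq_card.
apply/fintype.subsetP => _ /imsetP[q + ->]; rewrite !inE bB cB /= => /forall_inP qb.
apply/forall_inP => e eB; rewrite !permM tpermR; apply: qb.
by case: tpermP => // ->.
Qed.

(** Each order has exactly one first element in [B], and by symmetry all elements of [B] come first
    equally often. *)
Lemma first_at_card B b : b \in B -> (#|B| * #|first_at B b| = #|{perm T}|)%N.
Proof.
move=> bB.
have cst c : c \in B -> #|first_at B c| = #|first_at B b|.
  by move=> cB; apply/eqP; rewrite eqn_leq !first_at_le.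
rewrite -sum_nat_const -(eq_bigr _ cst) -[RHS]sum1_card.
under eq_bigr do rewrite -sum1_card big_mkcond.
rewrite exchange_big /=; apply: eq_bigr => q _.
rewrite -big_mkcondr /=.
pose m := [arg min_(c < b in B) enum_rank (q c)]%N.
have [mB mP] : m \in B /\ forall c, c \in B -> (enum_rank (q m) <= enum_rank (q c))%N.
  by rewrite /m; case: arg_minnP.
rewrite (big_pred1 m) // => c /=; rewrite !inE.
apply/andP/eqP => [[cB /andP[_ /forall_inP cm]]|->].
  apply: (@perm_inj _ q); apply: enum_rank_inj; apply/val_inj/eqP.
  by rewrite eqn_leq cm// mP.
by split => //; rewrite mB; apply/forall_inP.
Qed.

(** Union bound over [B :\: C], each point of which comes first in [B] with probability
    [1 / #|B|]. *)
Lemma card_first_notin B C (P : {set {perm T}}) :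
  (forall q, q \in P -> exists2 b, b \in B :\: C & q \in first_at B b) ->
  (#|B| * #|P| <= #|B :\: C| * #|{perm T}|)%N.
Proof.
move=> PB; apply: (@leq_trans (#|B| * \sum_(b in B :\: C) #|first_at B b|)).
  rewrite leq_mul2l; apply/orP; right.
  under eq_bigr do rewrite -sum1_card big_mkcond.
  rewrite exchange_big -sum1_card big_mkcond /=; apply: leq_sum => q _.
  case: ifP => // /PB[b bBC bq].
  by rewrite (bigD1 b)//= bq.
rewrite big_distrr /= -sum_nat_const; apply: leq_sum => b.
by rewrite inE => /andP[_ bB]; rewrite first_at_card.
Qed.

End RandomOrder.

Section FiniteModels.
Local Open Scope group_scope.
Variable H : groupType.

Definition is_action (Y : Type) (p : H -> Y -> Y) : Prop :=
  (forall y, p 1 y = y) /\ (forall g h y, p (g * h) y = p g (p h y)).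

Lemma coset_action (N : set H) (e : H) :
  group_closed (mem N) -> finite_index N -> ~ N e ->
  exists (Y : finType) (y0 : Y) (p : H -> Y -> Y),
    is_action p /\ forall y, p e y != y.
Proof.
move=> [N1 NB] Nfin Ne.
have {Nfin} [F FE] : exists F : {fset (set H)}, [set` F] = range (lcoset_of N).
  by exists (fset_set (range (lcoset_of N))); rewrite fset_setK.
have lM (A : set H) g h : lcoset_of (lcoset_of A g) h = lcoset_of A (h * g).
  by apply/seteqP; split => [_ [_ [n An <-] <-]|_ [n An <-]];
    [exists n => //; rewrite mulgA|exists (g * n); [exists n|rewrite mulgA]].
have l1 (A : set H) : lcoset_of A 1 = A.
  by apply/seteqP; split => [_ [n An <-]|n An]; [|exists n]; rewrite ?mul1g.
have FP (A : set H) : A \in F <-> exists g, A = lcoset_of N g.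
  split=> [AF|[g ->]].
    have : [set` F] A by [].
    by rewrite FE => -[g _ <-]; exists g.
  suff : [set` F] (lcoset_of N g) by [].
  by rewrite FE; exists g.
have tF h (C : F) : lcoset_of (val C) h \in F.
  have /FP[g gC] : val C \in F by exact: valP.
  by apply/FP; exists (h * g); rewrite gC lM.
pose t h (C : F) : F := [` tF h C]%fset.
have tM g h C : t (g * h) C = t g (t h C) by apply: val_inj; rewrite /= lM.
have t1 C : t 1 C = C by apply: val_inj; rewrite /= l1.
have tinj h : injective (t h).
  by apply: (can_inj (g := t h^-1)) => C; rewrite -tM mulVg t1.
(* [H] acts on permutations of the coset space, not on the cosets: [N] need not be normal, so [e]
   may fix some coset. Composition with a nontrivial permutation moves every permutation, and [e]
   does move the coset [N]. *)
exists {perm F}, 1, (fun h q => q * perm (@tinj h)); split; [split|].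
- by move=> q; apply/permP => C; rewrite permM permE t1.
- by move=> g h q; apply/permP => C; rewrite !permM !permE tM.
- move=> q; apply/eqP => /permP qE; apply: Ne.
  have NF : N \in F by apply/FP; exists 1; rewrite l1.
  have := qE (q^-1 [` NF]%fset); rewrite permM permKV permE => /(congr1 val) /= eN.
  by rewrite -eN; exists 1; [exact: set_mem|rewrite mulg1].
Qed.

(** Take the product of one coset action for each [e] in [E]; then [e] always moves its own
    coordinate. *)
Lemma free_finite_action (E : seq H) : residually_finite H ->
  (forall e, e \in E -> e != 1) ->
  exists (Y : finType) (y0 : Y) (p : H -> Y -> Y),
    is_action p /\ forall e y, e \in E -> p e y != y.
Proof.
move=> rfH; elim: E => [|e E IH] E1.
  by exists unit, tt, (fun _ y => y).
have [|Y [y0 [p [[p1 pM] pE]]]] := IH.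
  by move=> f fE; apply: E1; rewrite inE fE orbT.
have [N [Ng Nf Ne]] := rfH e (E1 e (mem_head _ _)).
have [Z [z0 [q [[q1 qM] qe]]]] := coset_action Ng Nf Ne.
exists (Y * Z)%type, (y0, z0), (fun h w => (p h w.1, q h w.2)); split; [split|].
- by case=> y z /=; rewrite p1 q1.
- by move=> g h [y z] /=; rewrite pM qM.
- move=> f [y z] /=; rewrite inE => /orP[/eqP ->|fE]; apply/eqP => -[py qz].
    by have := qe z; rewrite qz eqxx.
  by have := pE f y fE; rewrite py eqxx.
Qed.

Lemma is_actionVK (Y : Type) (p : H -> Y -> Y) : is_action p ->
  forall h, cancel (p h) (p h^-1).
Proof. by move=> [p1 pM] h y; rewrite -pM mulVg p1. Qed.

Lemma is_actionKV (Y : Type) (p : H -> Y -> Y) : is_action p ->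
  forall h, cancel (p h^-1) (p h).
Proof. by move=> [p1 pM] h y; rewrite -pM mulgV p1. Qed.

(* Order [Y] at random and let [s y] be the [f] in a Foelner set [F] for which
   [f^-1 y] comes first.  Then [s (k y) = k * s y] as soon as the first of the
   points [f^-1 y], for [f] in the union of [F] and [k^-1 F], belongs to both. *)
Lemma almost_equivariant_map (K : seq H) (n : nat) :
  amenable H -> residually_finite H ->
  exists (Y : finType) (y0 : Y) (p : H -> Y -> Y) (s : Y -> H),
    is_action p /\ forall k, k \in K ->
      (n * #|[set y | s (p k y) != (k * s y)%g]%SET| <= #|Y|)%N.
Proof.
move=> amH rfH.
pose K' := [fset k^-1 | k in K]%fset.
(* The factor [size K] pays for a union bound over [K]. Inverses occur because [s (p k y)] is
   decided by the points [f^-1 (k y) = (k^-1 f)^-1 y]. *)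
have [F F0 FK] := amH K' (n * size K)%N.
pose kF k := [fset (k^-1 * f)%g | f in F]%fset.
pose U := (F `|` \bigcup_(k <- K) kF k)%fset.
(* If these quotients move every point, then [f] is determined by [p f^-1 y] for [f] in [U], and
   Foelner's estimate in [H] carries over to points of [Y]. *)
pose E := [seq e <- [seq (f * g^-1)%g | f <- U, g <- U] | e != 1].
have [|Y [y0 [p [pA pE]]]] := @free_finite_action E rfH.
  by move=> e; rewrite mem_filter => /andP[].
have [f0 f0F] : exists f0, f0 \in F by exact/fset0Pn.
have pinj k y f g : k \in K -> f \in (F `|` kF k)%fset -> g \in (F `|` kF k)%fset ->
    p f^-1 y = p g^-1 y -> f = g.
  move=> kK fF gF fg; apply/eqP; rewrite -divg_eq1; apply/negPn/negP => fg1.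
  have sub h : h \in (F `|` kF k)%fset -> h \in U.
    rewrite !inE => /orP[->//|hk]; apply/orP; right.
    by apply/bigfcupP; exists k => //; rewrite kK.
  have fgE : (f * g^-1)%g \in E.
    rewrite mem_filter fg1 /=; apply/allpairsP; exists (f, g).
    by split => //=; exact: sub.
  have := pE _ y fgE.
  by rewrite /= pA.2 -fg is_actionKV// eqxx.
pose s (q : {perm Y}) y : H :=
  val [arg min_(f < [` f0F]%fset) enum_rank (q (p (val f)^-1 y))]%N.
have sF q y : s q y \in F by exact: valP.
have sP (q : {perm Y}) y f : f \in F ->
    (enum_rank (q (p (s q y)^-1 y)) <= enum_rank (q (p f^-1 y)))%N.
  move=> fF; rewrite /s; case: arg_minnP => //= g _ gP.
  exact: (gP [` fF]%fset).
pose bad k y := [set q : {perm Y} | s q (p k y) != (k * s q y)%g]%SET.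
(* For fixed [k] and [y], an order is bad only if the first point of [B] lies outside [C]. The
   points of [B :\: C] come from the symmetric difference of [F] and [k^-1 F]. *)
have badP k y : k \in K -> (n * size K * #|bad k y| <= #|{perm Y}|)%N.
  move=> kK; pose pt (S : {fset H}) := [set z in [seq p f^-1 y | f <- S]]%SET.
  pose B := pt (F `|` kF k)%fset; pose C := pt (F `&` kF k)%fset.
  have kFP f : (f \in kF k) = ((k * f)%g \in F).
    apply/imfsetP/idP => [[g gF ->]|kfF]; first by rewrite mulVKg.
    by exists (k * f)%g; rewrite ?mulKg.
  have cB : #|B| = #|` (F `|` kF k)%fset|.
    rewrite /B cardsE (card_uniqP _) ?size_map// map_inj_in_uniq ?fset_uniq//.
    by move=> f g fF gF; exact: (pinj k y).
  have cBC : (#|B :\: C| <= #|` (kF k `\` F `|` F `\` kF k)%fset|)%N.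
    apply: (@leq_trans #|pt (kF k `\` F `|` F `\` kF k)%fset|); last first.
      by rewrite cardsE; apply: leq_trans (card_size _) _; rewrite size_map.
    apply/subset_leq_card/fintype.subsetP => z; rewrite !inE.
    move=> /andP[zC /mapP[f fU zE]]; apply/mapP; exists f => //.
    have : f \notin (F `&` kF k)%fset by apply: contra zC => fI; apply/mapP; exists f.
    by move: fU; rewrite !inE; case: (f \in F); case: (f \in kF k).
  have B0 : (0 < #|B|)%N.
    rewrite cB cardfs_gt0; apply/fset0Pn; exists f0.
    by rewrite inE f0F.
  have FB : (#|` F| <= #|B|)%N.
    by rewrite cB; apply: fsubset_leq_card; exact: fsubsetUl.
  rewrite -(leq_pmul2l B0).
  have : (#|B| * #|bad k y| <= #|B :\: C| * #|{perm Y}|)%N.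
    apply: card_first_notin => q; rewrite inE => sk.
    have yk f : p f^-1 (p k y) = p (k^-1 * f)^-1 y by rewrite invgM invgK pA.2.
    have F1 g f : g \in F -> f \in F -> (k^-1 * f)%g \in (F `|` kF k)%fset.
      by move=> _ fF; rewrite inE kFP mulVKg fF orbT.
    have FC f : f \in F -> (k * f)%g \in F -> p f^-1 y \in C.
      by move=> fF kfF; rewrite inE; apply/mapP; exists f; rewrite // inE fF kFP.
    have BF f : f \in F -> p f^-1 y \in B.
      by move=> fF; rewrite inE; apply/mapP; exists f; rewrite // inE fF.
    have BkF f : f \in F -> p f^-1 (p k y) \in B.
      by move=> fF; rewrite yk inE; apply/mapP; exists (k^-1 * f)%g;
        rewrite // inE kFP mulVKg fF orbT.
    have CP z : z \in C -> exists f, [/\ f \in F, (k * f)%g \in F & z = p f^-1 y].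
      rewrite inE => /mapP[f + ->]; rewrite inE kFP => /andP[fF kfF].
      by exists f.
    pose a := p (s q y)^-1 y; pose b := p (s q (p k y))^-1 (p k y).
    have minU z : z \in B -> (enum_rank (q a) <= enum_rank (q z))%N ||
        (enum_rank (q b) <= enum_rank (q z))%N.
      rewrite inE => /mapP[f + ->]; rewrite inE => /orP[fF|]; first by rewrite sP.
      rewrite kFP => kfF; have := sP q (p k y) _ kfF.
      by rewrite (yk (k * f)%g) mulKg => ->; rewrite orbT.
    (* [B] is the union of the points given by [F], of which [a] is first, and those given by
       [k^-1 F], of which [b] is first. So the earlier of [a] and [b] is first in [B]; if it
       belonged to [C], the two would coincide and give [s q (p k y) = k * s q y]. *)
    have [ab|ba] := leqP (enum_rank (q a)) (enum_rank (q b)).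
      exists a; last first.
        rewrite inE BF//=; apply/forall_inP => z /minU /orP[//|]; exact: leq_trans.
      rewrite inE BF// andbT; apply: contra sk => aC.
      have [f [fF kfF af]] := CP _ aC.
      have fs : f = s q y.
        apply: (pinj k y) => //; first by rewrite inE fF.
          by rewrite inE sF.
      have := sP q (p k y) _ kfF; rewrite (yk (k * f)%g) mulKg -af => ba.
      have /perm_inj : q a = q b.
        by apply/enum_rank_inj/val_inj/eqP; rewrite eqn_leq ab.
      rewrite /a /b yk => /(pinj k y)/= -> //; rewrite ?mulVKg// ?inE ?sF//.
      by rewrite kFP mulVKg sF orbT.
    exists b; last first.
      rewrite inE BkF//=; apply/forall_inP => z /minU /orP[|//]; apply: leq_trans.
      exact: ltnW.
    rewrite inE BkF// andbT; apply/negP => bC.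
    have [f [fF kfF bf]] := CP _ bC.
    by move: ba; rewrite ltnNge bf sP.
  move=> /(leq_mul (leqnn (n * size K))) h.
  rewrite mulnCA (leq_trans h)// mulnA leq_mul2r; apply/orP; right.
  apply: leq_trans FB; apply: leq_trans (FK k^-1 _).
    by rewrite leq_mul2l cBC orbT.
  by apply/imfsetP; exists k.
have [->|K0] := eqVneq K [::].
  by exists Y, y0, p, (s 1%g).
(* Averaging over all orders: the bound for each pair [k], [y] bounds the mean weighted number of
   bad points, and some order does no worse than the mean. *)
have [q qP] : exists q : {perm Y},
    (\sum_(k <- K) n * #|[set y | q \in bad k y]%SET| <= #|Y|)%N.
  apply/not_existsP => qP.
  have lower : (#|{perm Y}| * (size K * #|Y|.+1) <=
      \sum_(q : {perm Y}) size K * \sum_(k <- K) n * #|[set y | q \in bad k y]%SET|)%N.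
    rewrite -sum_nat_const; apply: leq_sum => q _.
    by rewrite leq_mul2l; apply/orP; right; rewrite ltnNge; apply/negP.
  have upper : (\sum_(q : {perm Y}) size K * \sum_(k <- K)
      n * #|[set y | q \in bad k y]%SET| <= #|{perm Y}| * (size K * #|Y|))%N.
    under eq_bigr do rewrite big_distrr /=.
    rewrite exchange_big /=.
    apply: (@leq_trans (\sum_(k <- K) #|Y| * #|{perm Y}|)%N); last first.
      by rewrite big_const_seq count_predT iter_addn_0 mulnC mulnA mulnC.
    rewrite big_seq [leqRHS]big_seq; apply: leq_sum => k kK.
    apply: (@leq_trans (\sum_(y : Y) n * size K * #|bad k y|)%N); last first.
      by rewrite -sum_nat_const; apply: leq_sum => y _; exact: badP.
    rewrite -!big_distrr /= mulnA [(size K * n)%N]mulnC leq_mul2l.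
    apply/orP; right.
    under eq_bigr do rewrite -sum1_card big_mkcond.
    under [leqRHS]eq_bigr do rewrite -sum1_card big_mkcond.
    rewrite exchange_big /=; apply: leq_sum => y _; apply: leq_sum => q _.
    by rewrite inE.
  have := leq_trans lower upper.
  rewrite leq_pmul2l; last by apply/card_gt0P; exists 1%g.
  by rewrite leq_pmul2l ?ltnn// lt0n size_eq0.
exists Y, y0, p, (s q); split=> // k kK; apply: leq_trans qP.
rewrite (big_rem k)//=; apply: leq_trans (leq_addr _ _).
rewrite leq_mul2l; apply/orP; right; apply: subset_leq_card.
by apply/fintype.subsetP => y; rewrite !inE.
Qed.

End FiniteModels.

Import Order.TTheory GRing.Theory Num.Theory.
Import numFieldNormedType.Exports.

Local Open Scope ring_scope.

(** * Approximation of measurable sets *)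

Section SymmetricDifference.
Context d (X : measurableType d) (R : realType) (mu : probability X R).
Implicit Types A B C : set X.

Lemma measurableY A B : measurable A -> measurable B -> measurable (A `+` B).
Proof. by move=> mA mB; apply: measurableU; apply: measurableD. Qed.

Lemma measureY_triangle A B C : measurable A -> measurable B -> measurable C ->
  (mu (A `+` C) <= mu (A `+` B) + mu (B `+` C))%E.
Proof.
move=> mA mB mC; apply: le_trans (measureU2 _ _ _); try exact: measurableY.
apply: le_measure; rewrite ?inE.
- exact: measurableY.
- by apply: measurableU; exact: measurableY.
- by rewrite /setY => x; have [Bx|Bx] := pselect (B x) => -[[]|[]] ? ?;
    [right; left|left; right|left; left|right; right].
Qed.

Lemma setYU_sub A A' B B' : (A `|` A') `+` (B `|` B') `<=` (A `+` B) `|` (A' `+` B').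
Proof.
rewrite /setY => x /= [[[]h /not_orP[]]|[[]h /not_orP[]]]; tauto.
Qed.

Lemma setYC_compl A B : ~` A `+` ~` B = A `+` B.
Proof.
apply/seteqP; split => x; rewrite /setY/=.
  by move=> [[a /contrapT b]|[b /contrapT a]]; [right|left].
by move=> [[a b]|[b a]]; [right|left]; split => //; apply/not_notP.
Qed.

Lemma measureYU A A' B B' : measurable A -> measurable B ->
  measurable A' -> measurable B' ->
  (mu ((A `|` A') `+` (B `|` B')) <= mu (A `+` B) + mu (A' `+` B'))%E.
Proof.
move=> mA mB mA' mB'; apply: le_trans (measureU2 _ _ _); try exact: measurableY.
apply: le_measure; rewrite ?inE; last exact: setYU_sub.
- by apply: measurableY; apply: measurableU.
- by apply: measurableU; exact: measurableY.
Qed.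

Lemma measureY_ae0 A B : measurable A -> measurable B ->
  (\forall x \ae mu, A x <-> B x) -> mu (A `+` B) = 0%E.
Proof.
move=> mA mB AB; apply/negligibleP; first exact: measurableY.
apply: negligibleS AB => x /=; rewrite /setY/= => ABx; tauto.
Qed.

Lemma ae_measure_eq A B : measurable A -> measurable B ->
  (\forall x \ae mu, A x <-> B x) -> mu A = mu B.
Proof.
move=> mA mB AB; apply/eqP; rewrite eq_le; apply/andP.
suff H C D : measurable C -> measurable D -> (\forall x \ae mu, C x <-> D x) ->
    (mu C <= mu D)%E.
  by split; apply: H => //; apply: filterS AB => x; tauto.
move=> mC mD CD; have mCD := measurableY mC mD; apply: (@le_trans _ _ (mu (D `|` (C `+` D)))).
  apply: le_measure; rewrite ?inE //; first exact: measurableU.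
  by move=> x Cx; have [Dx|Dx] := pselect (D x); [left|right; left].
suff <- : (mu D + mu (C `+` D) = mu D)%E by exact: measureU2.
by rewrite measureY_ae0 ?adde0.
Qed.

Lemma measure_bigcup_tail (A : (set X)^nat) (e : R) : (forall n, measurable (A n)) ->
  0 < e -> exists n, (mu (\bigcup_k A k `\` \big[setU/set0]_(i < n) A i) < e%:E)%E.
Proof.
move=> mA e0; pose D n := \bigcup_k A k `\` \big[setU/set0]_(i < n) A i.
have mbA : measurable (\bigcup_k A k) by exact: bigcup_measurable.
have mD n : measurable (D n).
  by apply: measurableD => //; exact: bigsetU_measurable.
have D0 : \bigcap_n D n = set0.
  apply/seteqP; split => // x Dx; have [[k _ Akx] _] := Dx 0%N I.
  by have [_] := Dx k.+1 I; apply; rewrite big_ord_recr; right.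
have niD : nonincreasing_seq D.
  move=> m n mn; apply/subsetPset; apply: setDS; exact: subset_bigsetU.
have cvgD : (mu \o D @ \oo --> (0 : \bar R))%E.
  rewrite -(measure0 mu) -D0; apply: nonincreasing_cvg_mu => //.
  - by rewrite -ge0_fin_numE// fin_num_measure.
  - by rewrite D0.
have [n _ /(_ n (leqnn _)) nP] : \forall n \near \oo, (mu (D n) < e%:E)%E.
  apply: (cvgD [set x | (x < e%:E)%E]); apply: open_nbhs_nbhs.
  by split; [exact: open_ereal_lt_ereal|rewrite /= lte_fin].
by exists n.
Qed.

End SymmetricDifference.

Section Approximation.

(** NOR generates all Boolean operations, so inductions have a single compound case. Keeping the
    expression as data makes it possible to count expressions later on. *)
Inductive bexp (I : Type) := BLeaf of I | BNor of bexp I & bexp I.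

Fixpoint bset (I Z : Type) (C : I -> set Z) (b : bexp I) : set Z :=
  match b with
  | BLeaf i => C i
  | BNor b1 b2 => ~` (bset C b1 `|` bset C b2)
  end.

Context d (X : measurableType d) (R : realType) (mu : probability X R).

Lemma measurable_bset (I : Type) (C : I -> set X) (b : bexp I) :
  (forall i, measurable (C i)) -> measurable (bset C b).
Proof. by move=> mC; elim: b => //= a ma b mb; apply/measurableC/measurableU. Qed.

Definition approximable (I : Type) (C : I -> set X) (A : set X) : Prop :=
  forall e : R, 0 < e -> exists b, (mu (A `+` bset C b) < e%:E)%E.

(** The sets [B] with the required property form a sigma-algebra: a countable union is within
    [e / 2] of a finite one, which is approximated term by term. *)
Lemma approximable_sigma (I Z : Type) (f : X -> Z) (C : I -> set Z) (i0 : I) :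
  (forall i, measurable (f @^-1` C i)) ->
  forall B, <<s range C >> B ->
    measurable (f @^-1` B) /\ approximable (fun i => f @^-1` C i) (f @^-1` B).
Proof.
move=> mC; set D := fun i => f @^-1` C i.
have mb b : measurable (bset D b) by exact: measurable_bset.
have app0 : approximable D set0.
  (* This expression denotes the complement of the union of a set with its own complement. *)
  move=> e e0; exists (BNor (BLeaf i0) (BNor (BLeaf i0) (BLeaf i0))).
  rewrite /= setUid setUv setCT setYK measure0; exact: e0.
have appU A B : measurable A -> measurable B ->
    approximable D A -> approximable D B -> approximable D (A `|` B).
  move=> mA mB aA aB e e0; have e20 : 0 < e / 2 by rewrite divr_gt0.
  have [[a ha] [b hb]] := (aA _ e20, aB _ e20).
  exists (BNor (BNor a b) (BNor a b)); rewrite /= setUid setCK.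
  apply: le_lt_trans (measureYU mu mA (mb a) mB (mb b)) _.
  by rewrite [e in (_ < e%:E)%E]splitr EFinD lteD.
apply: smallest_sub; last first.
  move=> _ [i _ <-]; split; first exact: mC.
  by move=> e e0; exists (BLeaf i); rewrite /= setYK measure0 lte_fin.
split.
- by rewrite preimage_set0.
- move=> A [mA aA]; rewrite setTD preimage_setC; split; first exact: measurableC.
  move=> e /aA[b hb]; exists (BNor b b).
  by rewrite /= setUid setYC_compl.
- move=> A mA; rewrite preimage_bigcup.
  have mfA n := (mA n).1; split; first exact: bigcup_measurable.
  have aU n : approximable D (\big[setU/set0]_(i < n) (f @^-1` A i)).
    elim: n => [|n IH]; first by rewrite big_ord0.
    rewrite big_ord_recr; apply: appU => //; last exact: (mA n).2.
    exact: bigsetU_measurable.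
  move=> e e0; have e20 : 0 < e / 2 by rewrite divr_gt0.
  have [n hn] := measure_bigcup_tail mu mfA e20.
  have [b hb] := aU n _ e20.
  exists b; apply: le_lt_trans (measureY_triangle mu _
    (B := \big[setU/set0]_(i < n) (f @^-1` A i)) _ _) _ => //.
  + exact: bigcup_measurable.
  + exact: bigsetU_measurable.
  rewrite [e in (_ < e%:E)%E]splitr EFinD lteD//.
  rewrite /setY [X in _ `|` X](_ : _ = set0) ?setU0//.
  apply/seteqP; split => // x [+ nx].
  rewrite -(bigcup_mkord n (fun i => f @^-1` A i)) => -[k _ kx].
  by apply: nx; exists k.
Qed.

(** Convergence of [T i] to the identity, tested on [A]. A general filter is used because the index
    will be a natural number, a group element or a pair of both. *)
Definition nearly_fixed (I : Type) (F : set_system I) (T : I -> X -> X)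
    (A : set X) : Prop :=
  forall e : R, 0 < e ->
    \forall i \near F, (mu (T i @^-1` A `+` A) < e%:E)%E.

(** An [e / 3] argument: approximate [A] by a Boolean combination of the [C j]; as [T i] preserves
    [mu], the preimages are equally close to each other. *)
Lemma nearly_fixed_approximable (I : Type) (F : set_system I) (T : I -> X -> X)
    (J : Type) (C : J -> set X) : Filter F ->
  (forall i, measurable_fun setT (T i)) ->
  (forall i A, measurable A -> mu (T i @^-1` A) = mu A) ->
  (forall j, measurable (C j)) ->
  (forall A, measurable A -> approximable C A) ->
  (forall j, nearly_fixed F T (C j)) ->
  forall A, measurable A -> nearly_fixed F T A.
Proof.
move=> FF mT Tmu mC appC fixC.
have mTA i A : measurable A -> measurable (T i @^-1` A).
  by move=> mA; rewrite -[_ @^-1` _]setTI; exact: mT.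
have mb b : measurable (bset C b) by exact: measurable_bset.
have fixb b : nearly_fixed F T (bset C b).
  elim: b => //= a IHa b IHb e e0; have e20 : 0 < e / 2 by rewrite divr_gt0.
  apply: filterS2 (IHa _ e20) (IHb _ e20) => i ha hb.
  rewrite -[X in mu (X `+` _)]/(~` (T i @^-1` bset C a `|` T i @^-1` bset C b)) setYC_compl.
  apply: le_lt_trans (measureYU mu (mTA i _ (mb a)) (mb a) (mTA i _ (mb b)) (mb b)) _.
  by rewrite [e in (_ < e%:E)%E]splitr EFinD lteD.
move=> A mA e e0; have e30 : 0 < e / 3 by rewrite divr_gt0.
have [b hb] := appC A mA _ e30.
apply: filterS (fixb b _ e30) => i hi.
apply: le_lt_trans (measureY_triangle mu (mTA i _ mA) (mTA i _ (mb b)) mA) _.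
have -> : T i @^-1` A `+` T i @^-1` bset C b = T i @^-1` (A `+` bset C b) by [].
rewrite Tmu; last exact: measurableY.
have -> : e = e / 3 + (e / 3 + e / 3) by field.
rewrite EFinD lteD//; apply: le_lt_trans (measureY_triangle mu (mTA i _ (mb b)) (mb b) mA) _.
by rewrite EFinD lteD// setYC.
Qed.

End Approximation.

(** * Entropy of labellings *)

Section Sums.
Context (R : realType).
Implicit Types T : choiceType.

Lemma esum_inj (T T' : choiceType) (j : T -> T') (a : T' -> \bar R) :
  injective j -> (forall t, ~ range j t -> a t = 0%E) ->
  \esum_(t in [set: T']) a t = \esum_(t in [set: T]) a (j t).
Proof.
move=> jinj a0; rewrite -(esum_image setT j a); last by move=> x y _ _; exact: jinj.
rewrite [RHS]esum_mkcond; apply: eq_esum => t _; case: ifPn => //.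
by rewrite notin_setE => /a0.
Qed.

Lemma esumZl T (I : set T) (k : R) (a : T -> \bar R) : 0 <= k ->
  (forall t, (0 <= a t)%E) ->
  (\esum_(t in I) (k%:E * a t) = k%:E * \esum_(t in I) a t)%E.
Proof.
move=> k0 a0; rewrite /esum -ereal_supZl//.
  congr ereal_sup; apply/seteqP; split => [_ [A AI <-]|_ [_ [A AI <-] <-]].
    by exists (\sum_(x \in A) a x)%E; [exists A|rewrite ge0_mule_fsumr].
  by exists A; rewrite // ge0_mule_fsumr.
apply/set0P; exists (\sum_(x \in set0) a x)%E; exists set0 => //; exact: fsets_set0.
Qed.

Lemma esum_exchange T (T' : choiceType) (a : T -> T' -> \bar R) :
  (forall t u, (0 <= a t u)%E) ->
  \esum_(t in [set: T]) \esum_(u in [set: T']) a t u =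
  \esum_(u in [set: T']) \esum_(t in [set: T]) a t u.
Proof.
move=> a0; rewrite !esum_esum//.
rewrite (reindex_esum ([set: T'] `*`` fun=> [set: T]) _ (fun x => (x.2, x.1)))//.
by split => // [[u t] [u' t'] _ _ /= [-> ->]//|[t u] _ /=]; exists (u, t).
Qed.

End Sums.

Section Labels.
Context d (X : measurableType d) (R : realType) (mu : probability X R).

Definition mlabel (T : Type) (f : X -> T) : Prop :=
  forall t, measurable (f @^-1` [set t]).

Definition law (T : Type) (f : X -> T) (t : T) : R := fine (mu (f @^-1` [set t])).

Lemma law_ge0 (T : Type) (f : X -> T) t : 0 <= law f t.
Proof. exact: fine_ge0. Qed.

Lemma EFin_fine_mu A : measurable A -> (fine (mu A))%:E = mu A.
Proof. by move=> mA; rewrite fineK// fin_num_measure. Qed.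

Lemma fine_mu_le1 A : measurable A -> fine (mu A) <= 1.
Proof. by move=> mA; rewrite -lee_fin EFin_fine_mu//; exact: probability_le1. Qed.

Lemma entropy_term_ge0 (x : R) : 0 <= x <= 1 -> 0 <= - (x * ln x).
Proof.
by move=> /andP[x0 x1]; rewrite -mulrN mulr_ge0// oppr_ge0 ln_le0.
Qed.

Lemma entropy_term_mu_ge0 A : measurable A ->
  (0 <= (- (fine (mu A) * ln (fine (mu A))))%:E)%E.
Proof. by move=> mA; rewrite lee_fin entropy_term_ge0// fine_ge0//= fine_mu_le1. Qed.

Lemma measurable_label_set (T : countType) (f : X -> T) (S : set T) :
  mlabel f -> measurable (f @^-1` S).
Proof.
move=> mf; have -> : f @^-1` S = \bigcup_(t in S) (f @^-1` [set t]).
  by apply/seteqP; split => [x Sx|x [t St /= ->]//]; exists (f x).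
have -> : \bigcup_(t in S) f @^-1` [set t] = \bigcup_n
    (if @choice.unpickle T n is Some t then
       if t \in S then f @^-1` [set t] else set0 else set0).
  apply/seteqP; split => [x [t St ft]|x [n _]].
    by exists (choice.pickle t) => //; rewrite choice.pickleK mem_set.
  case: choice.unpickle => // t; case: ifPn => // /set_mem St ft.
  by exists t.
apply: bigcup_measurable => n _; case: choice.unpickle => // t.
case: ifPn => // _; exact: mf.
Qed.

Lemma measure_label (T : countType) (f : X -> T) B : mlabel f -> measurable B ->
  mu B = \esum_(t in [set: T]) mu (B `&` f @^-1` [set t]).
Proof.
move=> mf mB; pose F n := B `&` [set x | choice.pickle (f x) = n].
have mF n : measurable (F n).
  apply: measurableI => //.
  exact: (measurable_label_set [set t | choice.pickle t = n] mf).
have {1}-> : B = \bigcup_n F n.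
  by apply/seteqP; split => [x Bx|x [n _ []//]]; exists (choice.pickle (f x)).
rewrite measure_semi_bigcup//; last 2 first.
  by move=> i j _ _ [x [[_ /= <-] [_ /= <-]]].
  exact: bigcup_measurable.
rewrite nneseries_esumT// (@esum_inj _ T _ choice.pickle).
- apply: eq_esum => t _; congr (mu (B `&` _)).
  by apply/seteqP; split => x /= => [/(pcan_inj choice.pickleK)|->].
- exact: pcan_inj choice.pickleK.
- move=> n nP; rewrite /F (_ : [set x | _] = set0) ?setI0 ?measure0//.
  by apply/seteqP; split => // x /= xn; apply: nP; exists (f x).
Qed.

(** This is the entropy of the partition into fibres. With labels in place of cells, a common
    refinement is a tuple of labels, and relabelling by an injection changes nothing. *)
Definition label_entropy (T : choiceType) (f : X -> T) : \bar R :=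
  \esum_(t in [set: T]) (- (law f t * ln (law f t)))%:E.

Lemma label_entropy_inj (T T' : choiceType) (j : T -> T') (f : X -> T) :
  injective j -> label_entropy (j \o f) = label_entropy f.
Proof.
move=> jinj; rewrite /label_entropy (@esum_inj _ _ _ j)//.
  apply: eq_esum => t _; rewrite /law.
  have -> // : (j \o f) @^-1` [set j t] = f @^-1` [set t].
  by apply/seteqP; split => x /= => [/jinj|->].
move=> t nt; rewrite /law (_ : _ @^-1` _ = set0) ?measure0 ?mul0r ?oppr0//.
by apply/seteqP; split => // x /= xt; apply: nt; exists (f x).
Qed.

(* Gibbs' inequality, term by term, for the reference distribution that repeats
   the previous letter with probability [1 - eta] and otherwise draws a fresh
   one; [b] tells whether [x] is the probability of a repetition. *)
Lemma gibbs_term (x p q eta : R) (b : bool) :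
  0 <= x <= p -> x <= q -> p <= 1 -> q <= 1 -> 0 < eta < 1 ->
  - (x * ln x) + x <=
    x * - ln p + (x * - ln (1 - eta) + (if b then 0 else (- ln eta - ln q) * x)) +
    p * ((1 - eta) * b%:R + eta * q).
Proof.
move=> /andP[x0 xp] xq p1 q1 /andP[e0 e1].
have [p0 q0] := (le_trans x0 xp, le_trans x0 xq).
have [->|xneq0] := eqVneq x 0.
  rewrite !mul0r oppr0 mulr0 !add0r if_same add0r mulr_ge0// addr_ge0//.
    by rewrite mulr_ge0// subr_ge0 ltW.
  by rewrite mulr_ge0// ltW.
have xgt0 : 0 < x by rewrite lt_neqAle eq_sym xneq0.
have pgt0 := lt_le_trans xgt0 xp; have qgt0 := lt_le_trans xgt0 xq.
(* The tangent inequality [ln (1 + t) <= t] at [t = y / x - 1], multiplied by [x]. *)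
have key y : 0 < y -> - (x * ln x) + x <= - (x * ln y) + y.
  move=> y0; have := @le_ln1Dx R (y / x - 1).
  have -> : -1 < y / x - 1 by rewrite ltrBrDl subrr divr_gt0.
  rewrite addrC subrK => /(_ isT); rewrite ln_div ?posrE// => h.
  have := ler_wpM2l x0 h; rewrite [x * (y / x - 1)]mulrBr mulr1.
  by rewrite [x * (y / x)]mulrC divfK// mulrBr; lra.
have e10 : 0 < 1 - eta by rewrite subr_gt0.
case: b.
  apply: le_trans (key (p * (1 - eta)) _) _; first exact: mulr_gt0.
  rewrite lnM ?posrE// mulr1 addr0.
  have : 0 <= p * (eta * q) by rewrite !mulr_ge0// ltW.
  by lra.
apply: le_trans (key (p * (eta * q)) _) _; first by rewrite !mulr_gt0.
rewrite lnM ?posrE ?mulr_gt0// lnM ?posrE// mulr0 add0r.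
have : 0 <= x * - ln (1 - eta).
  by rewrite mulr_ge0// oppr_ge0 ln_le0// gerBl ltW.
by lra.
Qed.

(** Given [f], encode [r] by the mixture with weight [1 - eta] on the guess [phi (f x)] and weight
    [eta] on the law of [c]. By Gibbs' inequality the cost bounds the conditional entropy of [r]:
    every letter costs at most [- ln (1 - eta)], and a wrongly guessed letter [n] costs a further
    [- ln eta - ln (law c n)]. *)
Lemma label_entropy_step (T : countType) (f : X -> T) (r c : X -> nat)
    (phi : T -> nat) (eta : R) :
  mlabel f -> mlabel r -> mlabel c ->
  (forall n, mu (r @^-1` [set n]) = mu (c @^-1` [set n])) -> 0 < eta < 1 ->
  (label_entropy (fun x => (f x, r x)) <= label_entropy f +
    ((- ln (1 - eta))%:E + \esum_(n in [set: nat])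
      ((- ln eta - ln (law c n))%:E *
        mu (r @^-1` [set n] `&` [set x | phi (f x) <> n]))))%E.
Proof.
move=> mf mr mc rc e01.
have pairE t n : (fun x => (f x, r x)) @^-1` [set (t, n)] =
    f @^-1` [set t] `&` r @^-1` [set n].
  by apply/seteqP; split => x /= [-> ->].
have mfr t n : measurable (f @^-1` [set t] `&` r @^-1` [set n]).
  exact: measurableI.
pose x t n := law (fun x => (f x, r x)) (t, n).
have xE t n : (x t n)%:E = mu (f @^-1` [set t] `&` r @^-1` [set n]).
  by rewrite /x /law pairE EFin_fine_mu.
have x0 t n : 0 <= x t n by exact: law_ge0.
have lawE (U : Type) (g : X -> U) t : mlabel g -> (law g t)%:E = mu (g @^-1` [set t]).
  by move=> mg; rewrite /law EFin_fine_mu.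
have law1 (U : Type) (g : X -> U) t : mlabel g -> law g t <= 1.
  by move=> mg; exact: fine_mu_le1.
have sum_x t : \esum_(n in [set: nat]) (x t n)%:E = (law f t)%:E.
  rewrite lawE// (measure_label mr (mf t)).
  by apply: eq_esum => n _.
have sum_law (U : countType) (g : X -> U) : mlabel g ->
    \esum_(t in [set: U]) (law g t)%:E = 1%E.
  move=> mg; rewrite -(@probability_setT _ _ _ mu) (measure_label mg measurableT).
  by apply: eq_esum => t _; rewrite setTI lawE.
have x_p t n : 0 <= x t n <= law f t.
  rewrite x0 /=; rewrite -lee_fin xE lawE// le_measure ?inE//.
have x_q t n : x t n <= law c n.
  by rewrite -lee_fin xE lawE// -rc le_measure ?inE//; exact: subIsetr.
have L0 n : 0 <= - ln eta - ln (law c n).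
  rewrite addr_ge0// oppr_ge0 ln_le0 ?law1//; lra.
pose L n := - ln eta - ln (law c n).
pose x' t n := if n == phi t then 0%E else ((L n)%:E * (x t n)%:E)%E.
have x'0 t n : (0 <= x' t n)%E.
  by rewrite /x'; case: ifP => // _; rewrite mule_ge0 ?lee_fin ?L0.
have lne0 : 0 <= - ln (1 - eta) by rewrite oppr_ge0 ln_le0//; lra.
have lnp0 t : 0 <= - ln (law f t) by rewrite oppr_ge0 ln_le0 ?law1.
pose h (y : R) := (- (y * ln y))%:E.
have h0 y : 0 <= y <= 1 -> (0 <= h y)%E by move=> ?; rewrite lee_fin entropy_term_ge0.
have x01 t n : 0 <= x t n <= 1.
  by have /andP[-> /le_trans ->] := x_p t n; rewrite ?law1.
have sum_h t : (\esum_(n in [set: nat]) h (x t n) <=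
    h (law f t) + ((- ln (1 - eta))%:E * (law f t)%:E + \esum_(n in [set: nat]) x' t n))%E.
  (* The linear terms of [gibbs_term] sum over [n] to [law f t] on either side; adding that amount
     lets the inequality be summed term by term. *)
  rewrite -(@leeD2rE _ (law f t)%:E)// -{1}sum_x -esumD; last 2 first.
    by move=> n _; rewrite h0.
    by move=> n _; rewrite lee_fin.
  pose s n : \bar R := (law f t * ((1 - eta) * (n == phi t)%:R + eta * law c n))%:E.
  have s0 n : (0 <= s n)%E.
    rewrite lee_fin mulr_ge0 ?law_ge0// addr_ge0// mulr_ge0 ?law_ge0//; lra.
  have sum_s : (\esum_(n in [set: nat]) s n = (law f t)%:E)%E.
    under eq_esum do rewrite /s EFinM.
    rewrite esumZl ?law_ge0//; last first.
      by move=> n; rewrite lee_fin addr_ge0// mulr_ge0 ?law_ge0//; lra.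
    under eq_esum do rewrite EFinD.
    rewrite esumD; last 2 first.
    + by move=> n _; rewrite lee_fin mulr_ge0//; lra.
    + by move=> n _; rewrite lee_fin mulr_ge0 ?law_ge0//; lra.
    under [X in (_ * (_ + X))%E]eq_esum do rewrite EFinM.
    rewrite esumZl; last 2 first.
    + by lra.
    + by move=> n; rewrite lee_fin law_ge0.
    rewrite sum_law// (_ : \esum_(n in _) _ = (1 - eta)%:E).
      by rewrite mule1 -EFinD subrK mule1.
    transitivity (\esum_(n in [set phi t]) ((1 - eta) * (n == phi t)%:R)%:E).
      rewrite [RHS]esum_mkcond; apply: eq_esum => n _; rewrite in_set1.
      by case: eqVneq => //; rewrite mulr0.
    by rewrite esum_set1 eqxx mulr1// lee_fin; lra.
  apply: (@le_trans _ _ (\esum_(n in [set: nat]) (((- ln (law f t))%:E * (x t n)%:E +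
      ((- ln (1 - eta))%:E * (x t n)%:E + x' t n)) + s n))%E).
    apply: le_esum => n _.
    have := @gibbs_term (x t n) (law f t) (law c n) eta (n == phi t) (x_p t n)
      (x_q t n) (law1 _ _ _ mf) (law1 _ _ _ mc) e01.
    rewrite /x' /s /h /L -!EFinM; case: ifP => _; rewrite -!EFinD lee_fin => /le_trans-> //.
      by rewrite !(mulrC (x t n)) addr0.
    by rewrite !(mulrC (x t n)).
  rewrite esumD//; last first.
    by move=> n _; rewrite adde_ge0 ?adde_ge0// -EFinM lee_fin mulr_ge0.
  rewrite sum_s esumD//; last 2 first.
    by move=> n _; rewrite -EFinM lee_fin mulr_ge0.
    by move=> n _; rewrite adde_ge0// -EFinM lee_fin mulr_ge0.
  rewrite esumD//; last first.
    by move=> n _; rewrite -EFinM lee_fin mulr_ge0.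
  have xe0 n : (0 <= (x t n)%:E)%E by rewrite lee_fin.
  rewrite esumZl// sum_x esumZl// sum_x.
  by rewrite leeD2r// /h -EFinM mulNr mulrC.
apply: (@le_trans _ _ (\esum_(t in [set: T]) \esum_(n in [set: nat]) h (x t n))).
  rewrite esum_esum; last by move=> t n _ _; rewrite h0.
  rewrite /label_entropy (_ : _ `*`` _ = setT); last by apply/seteqP; split.
  by apply: le_esum => -[t n] _.
apply: (@le_trans _ _ (\esum_(t in [set: T]) (h (law f t) +
    ((- ln (1 - eta))%:E * (law f t)%:E + \esum_(n in [set: nat]) x' t n)))%E).
  exact: le_esum.
have hl t : (0 <= h (law f t))%E by rewrite h0// law_ge0 law1.
have el t : (0 <= (- ln (1 - eta))%:E * (law f t)%:E)%E.
  by rewrite -EFinM lee_fin mulr_ge0 ?law_ge0.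
rewrite esumD//; last by move=> t _; rewrite adde_ge0// esum_ge0.
rewrite leeD2l// esumD//; last by move=> t _; exact: esum_ge0.
rewrite esumZl//; last by move=> t; rewrite lee_fin law_ge0.
rewrite sum_law// mule1 leeD2l// esum_exchange//.
apply: le_esum => n _.
have mS : measurable [set x | phi (f x) <> n].
  exact: (measurable_label_set [set t | phi t <> n] mf).
rewrite (measure_label mf (measurableI _ _ (mr n) mS)) -esumZl//.
apply: le_esum => t _; rewrite /x'; case: eqVneq => [->|nphi].
  by rewrite mule_ge0 ?lee_fin.
rewrite lee_wpmul2l ?lee_fin ?L0// xE le_measure ?inE//.
- by apply: measurableI => //; exact: measurableI.
- by move=> y [/= fy ry]; split => //; split => //=; rewrite fy => /esym/eqP; exact/negP.
Qed.

End Labels.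

Section SmallError.
Context d (X : measurableType d) (R : realType) (mu : probability X R).

(** Smallness of [nu] is required on finitely many labels only; beyond [n0] the domination by the
    law of [c] suffices, because [c] has finite entropy. *)
Lemma step_error_small (c : X -> nat) (eps : R) : mlabel c ->
  (label_entropy mu c < +oo)%E -> 0 < eps ->
  exists eta n0 delta, [/\ 0 < eta < 1, 0 < delta &
    forall nu : nat -> \bar R,
      (forall n, 0 <= nu n <= mu (c @^-1` [set n]))%E ->
      (forall n, (n < n0)%N -> nu n < delta%:E)%E ->
      ((- ln (1 - eta))%:E + \esum_(n in [set: nat])
        ((- ln eta - ln (law mu c n))%:E * nu n) <= eps%:E)%E].
Proof.
move=> mc Hc eps0; have e30 : 0 < eps / 3 by rewrite divr_gt0.
(* Chosen so that [- ln (1 - eta)] equals [eps / 3]. *)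
pose eta : R := 1 - expR (- (eps / 3)).
have eta01 : 0 < eta < 1.
  by rewrite subr_gt0 expR_lt1 oppr_lt0 e30 /= gtrBl expR_gt0.
have law1 n : law mu c n <= 1 by exact: fine_mu_le1.
pose L n := - ln eta - ln (law mu c n).
have lneta : 0 <= - ln eta by rewrite oppr_ge0 ln_le0//; lra.
have L0 n : 0 <= L n by rewrite addr_ge0// oppr_ge0 ln_le0.
have lawE n : (law mu c n)%:E = mu (c @^-1` [set n]) by rewrite EFin_fine_mu.
have law0 n : (0 <= (law mu c n)%:E)%E by rewrite lee_fin law_ge0.
pose f n : \bar R := ((L n)%:E * (law mu c n)%:E)%E.
have f0 n : (0 <= f n)%E by rewrite mule_ge0// lee_fin.
(* The series is [- ln eta] times the total mass 1, plus the entropy of [c]. *)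
have fsum : (\sum_(0 <= n <oo) f n < +oo)%E.
  rewrite nneseries_esumT// (_ : \esum_(n in _) _ = (- ln eta)%:E + label_entropy mu c)%E.
    by rewrite lte_add_pinfty// ltry.
  rewrite -[X in (X + _)%E]mule1 -(@probability_setT _ _ _ mu) (measure_label mu mc measurableT).
  rewrite -esumZl// -esumD; last 2 first.
    by move=> n _; rewrite mule_ge0.
    by move=> n _; rewrite lee_fin entropy_term_ge0// law_ge0 law1.
  apply: eq_esum => n _; rewrite setTI -lawE /f /L -!EFinM -EFinD; congr EFin; ring.
have tailcvg := nneseries_tail_cvg fsum (fun n _ => f0 n).
have [N _ /(_ N (leqnn _)) tailN] : \forall N \near \oo,
    (\sum_(N <= n <oo) f n < (eps / 3)%:E)%E.
  apply: (tailcvg [set x | (x < (eps / 3)%:E)%E]); apply: open_nbhs_nbhs.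
  by split; [exact: open_ereal_lt_ereal|rewrite /= lte_fin].
pose S := \sum_(0 <= n < N) L n.
have S0 : 0 <= S by exact: sumr_ge0.
(* The first [N] terms then add up to at most [S] times [eps / 3 / (1 + S)]; the added 1 keeps the
   denominator positive. *)
exists eta, N, (eps / 3 / (1 + S)); split=> //.
  by rewrite divr_gt0// ltr_pwDl.
move=> nu nule nult.
have nu0 n : (0 <= nu n)%E by have /andP[] := nule n.
have Lnu0 n : (0 <= (L n)%:E * nu n)%E by rewrite mule_ge0// lee_fin.
rewrite -/(L _) -nneseries_esumT// (nneseries_split _ N); last by move=> k _; exact: Lnu0.
have -> : eps = eps / 3 + (eps / 3 + eps / 3) by field.
rewrite EFinD leeD//.
  by rewrite /eta opprB addrC subrK expRK opprK.
rewrite EFinD leeD//.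
  apply: (@le_trans _ _ (\sum_(0 <= n < N) (L n * (eps / 3 / (1 + S)))%:E)%E).
    rewrite big_seq [leRHS]big_seq; apply: lee_sum => n.
    rewrite mem_index_iota => /andP[_ /nult/ltW nud].
    by rewrite EFinM lee_wpmul2l ?lee_fin ?L0.
  rewrite sumEFin lee_fin -mulr_suml -/S mulrA ler_pdivrMr ?ltr_pwDl//.
  by rewrite mulrDr mulr1 [S * _]mulrC lerDr ltW.
apply: le_trans (ltW tailN); apply: lee_nneseries => [n _ _|n _]; first exact: Lnu0.
apply: lee_wpmul2l; first by rewrite lee_fin; exact: L0.
by rewrite lawE; have /andP[] := nule n.
Qed.

End SmallError.

Section PartitionLabels.
Context d (X : measurableType d) (R : realType) (mu : probability X R).

Lemma partition_label (P : set (set X)) : measurable_partition P ->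
  exists c : X -> nat, [/\ mlabel c, (forall x, P (c @^-1` [set c x])) &
    (forall A x, P A -> A x -> A = c @^-1` [set c x])].
Proof.
move=> [/countable_injP[code codeinj] mP [Pcov Ptriv _]].
have cellP x : exists A, P A /\ A x.
  have : [set: X] x by [].
  by rewrite -Pcov => -[A PA Ax]; exists A.
pose cell x := projT1 (cid (cellP x)).
have [Pcell cellx] : (forall x, P (cell x)) /\ (forall x, cell x x).
  by split => x; have [] := projT2 (cid (cellP x)).
have cellE A x : P A -> A x -> A = cell x.
  by move=> PA Ax; apply: Ptriv => //; exists x; split => //; exact: cellx.
have fiberE x : (code \o cell) @^-1` [set (code \o cell) x] = cell x.
  apply/seteqP; split => y /=.
    by move/codeinj; rewrite !inE => /(_ (Pcell y) (Pcell x)) <-; exact: cellx.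
  by move=> /(cellE _ _ (Pcell x)) ->.
exists (code \o cell); split.
- move=> n; have [[x xn]|nn] := pselect (exists x, (code \o cell) x = n).
    by rewrite -xn fiberE; apply: mP.
  rewrite (_ : _ @^-1` _ = set0)//; apply/seteqP; split => // x /= xn.
  by apply: nn; exists x.
- by move=> x; rewrite fiberE.
- by move=> A x PA Ax; rewrite fiberE; exact: cellE.
Qed.

Lemma label_entropy_fibers (T : choiceType) (f : X -> T) :
  entropy mu [set f @^-1` [set f x] | x in [set: X]] = label_entropy mu f.
Proof.
have -> : [set f @^-1` [set f x] | x in [set: X]] = (fun t => f @^-1` [set t]) @` range f.
  by apply/seteqP; split => [_ [x _ <-]|_ [_ [x _ <-] <-]];
    [exists (f x) => //; exists x|exists x].
rewrite /entropy esum_image; last first.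
  move=> t u; rewrite !inE => -[x _ <-] [y _ <-] /seteqP[/(_ x erefl)]; exact.
rewrite esum_mkcond; apply: eq_esum => t _; case: ifPn => //.
rewrite notin_setE => nt; rewrite /law (_ : _ @^-1` _ = set0) ?measure0 ?mul0r ?oppr0//.
by apply/seteqP; split => // x /= xt; apply: nt; exists x.
Qed.

Lemma le_entropy (P Q : set (set X)) : P `<=` Q `|` [set set0] ->
  (forall A, Q A -> measurable A) -> (entropy mu P <= entropy mu Q)%E.
Proof.
move=> PQ mQ; rewrite /entropy esum_mkcond [leRHS]esum_mkcond.
apply: le_esum => A _; case: ifPn => [/set_mem/PQ[QA|->]|_].
- by rewrite mem_set.
- by rewrite measure0 mul0r oppr0 if_same.
- by case: ifPn => // /set_mem/mQ mA; exact: entropy_term_mu_ge0.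
Qed.

End PartitionLabels.

(** * Recurrent actions have zero naive entropy *)

Section NaiveEntropy.
Context (G : groupType) d (X : measurableType d) (R : realType)
  (mu : probability X R).
Implicit Types a : actions G mu.

Lemma act_measurable a g : measurable_fun setT (act a g).
Proof. exact: mp_fun_measurable. Qed.

Lemma act_preimage_measurable a g A : measurable A -> measurable (act a g @^-1` A).
Proof. by move=> mA; rewrite -[_ @^-1` _]setTI; exact: act_measurable. Qed.

Lemma act_mp a g A : measurable A -> mu (act a g @^-1` A) = mu A.
Proof. exact: mp_fun_mp. Qed.

Lemma action1 a : (a : Multiplicative.type _ _) 1%g = 1%g.
Proof.
apply: (@mulgI _ ((a : Multiplicative.type _ _) 1%g)).
by rewrite -gmulfM mulg1 mulg1.
Qed.

Lemma act1 a : \forall x \ae mu, act a 1%g x = x.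
Proof. rewrite /act action1; exact: Aut_fun_one. Qed.

Lemma mlabel_comp (T : Type) (f : X -> T) (S : X -> X) : measurable_fun setT S ->
  mlabel f -> mlabel (f \o S).
Proof. by move=> mS mf t; rewrite comp_preimage -[_ @^-1` _]setTI; exact: mS. Qed.

Lemma mlabel_names a (c : X -> nat) (s : seq G) : mlabel c ->
  mlabel (fun x => [seq c (act a w x) | w <- s]).
Proof.
move=> mc; elim: s => [|w r IH] t /=.
  have [->|t0] := eqVneq t [::].
    by rewrite (_ : _ @^-1` _ = setT)//; apply/seteqP; split.
  rewrite (_ : _ @^-1` _ = set0)//; apply/seteqP; split => // x /= t0'.
  by move: t0; rewrite -t0' eqxx.
case: t => [|n t].
  by rewrite (_ : _ @^-1` _ = set0)//; apply/seteqP; split.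
rewrite (_ : _ @^-1` _ = (act a w @^-1` (c @^-1` [set n])) `&`
    (fun x => [seq c (act a w0 x) | w0 <- r]) @^-1` [set t]); last first.
  by apply/seteqP; split => x /= [<- <-].
by apply: measurableI; [exact: act_preimage_measurable|exact: IH].
Qed.

(** Any point of a nonempty cell of the refinement determines that cell by its labels along [W], so
    the cell is a fibre of the name map; empty cells contribute nothing. *)
Lemma refinement_entropy_le a (P : set (set X)) (c : X -> nat) (W : {fset G})
    (s : seq G) : s =i W -> mlabel c ->
  (forall A x, P A -> A x -> A = c @^-1` [set c x]) ->
  (entropy mu (refinement a P W) <=
   label_entropy mu (fun x => [seq c (act a w x) | w <- s]))%E.
Proof.
move=> sW mc Pc; set f := fun x => _.
have mf : mlabel f by exact: mlabel_names.
rewrite -(label_entropy_fibers mu f); apply: le_entropy; last first.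
  by move=> _ [x _ <-].
move=> _ [A PA <-].
have [[x Ax]|A0] := pselect (\bigcap_(w in [set` W]) (act a w @^-1` A w) !=set0);
    last first.
  by right; apply/seteqP; split => // x Ax; case: A0; exists x.
left; exists x => //; apply/seteqP; split => y /=.
  move=> /eq_in_map fyx w /= wW; have := Ax w wW; rewrite /= => Awx.
  by rewrite (Pc _ _ (PA w wW) Awx) /= fyx// sW.
move=> Ay; apply/eq_in_map => w; rewrite sW => wW.
have := Ay w wW; rewrite /= (Pc _ _ (PA w wW) (Ax w wW)) /=.
by [].
Qed.

(** Letters are prepended one at a time. The identity stands at the end of the list, so [last 0]
    always reads the label at the identity, which serves as the guess for each new letter; the
    default 0 never occurs. *)
Lemma names_entropy_le a (c : X -> nat) (eta : R) (e : \bar R) (s : seq G) :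
  mlabel c -> 0 < eta < 1 ->
  (forall w, w \in s -> ((- ln (1 - eta))%:E + \esum_(n in [set: nat])
      ((- ln eta - ln (law mu c n))%:E *
        mu ((c \o act a w) @^-1` [set n] `&` [set x | c (act a 1%g x) <> n])) <= e)%E) ->
  (label_entropy mu (fun x => [seq c (act a w x) | w <- rcons s 1%g]) <=
     label_entropy mu c + \sum_(w <- s) e)%E.
Proof.
move=> mc e01; elim: s => [|w s IH] se.
  rewrite big_nil adde0 /= (_ : (fun x => _) = (fun n => [:: n]) \o (c \o act a 1%g))//.
  rewrite label_entropy_inj; last by move=> m n [].
  rewrite /label_entropy; apply: le_esum => n _; rewrite /law comp_preimage act_mp//.
have {}IH := IH (fun v vs => se v (mem_behead (s := w :: s) vs)).
rewrite big_cons addeCA addeC.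
set f := fun x => [seq c (act a w x) | w <- rcons s 1%g] in IH *.
have -> : (fun x => [seq c (act a w0 x) | w0 <- rcons (w :: s) 1%g]) =
    (fun p => p.2 :: p.1) \o (fun x => (f x, (c \o act a w) x)) by [].
rewrite label_entropy_inj; last by move=> [? ?] [? ?] /= [-> ->].
apply: le_trans (leeD IH (se w (mem_head _ _))).
apply: le_trans (@label_entropy_step _ _ _ mu _ f (c \o act a w) c (last 0%N) eta
  _ _ _ _ _) _ => //.
- exact: mlabel_names.
- exact: mlabel_comp (act_measurable a w) mc.
- by move=> n; rewrite comp_preimage act_mp.
- rewrite leeD2l// leeD2l//; apply: le_esum => n _.
  by rewrite (_ : [set x | _] = [set x | c (act a 1%g x) <> n])//;
    apply/seteqP; split => x /=; rewrite /f map_rcons last_rcons.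
Qed.

(** The sets [B n] with [n < n0], together with [delta], describe a basic neighbourhood of the
    identity. Quantifying over all of them frees the notion from any generating sequence. *)
Definition recurrent a : Prop :=
  forall (B : nat -> set X) (n0 : nat) (delta : R) (N : nat),
    (forall n, measurable (B n)) -> 0 < delta ->
    exists2 W : {fset G}, (N <= #|` W|)%N & forall w n, w \in W -> (n < n0)%N ->
      (mu (act a w @^-1` B n `+` B n) < delta%:E)%E.

Lemma recurrent_naive_entropy_of a P : recurrent a -> measurable_partition P ->
  (entropy mu P < +oo)%E -> (naive_entropy_of a P <= 0)%E.
Proof.
move=> reca mP HP; have [c [mc cP Pc]] := partition_label mP.
have Hc : (label_entropy mu c < +oo)%E.
  apply: le_lt_trans HP; rewrite -label_entropy_fibers; apply: le_entropy.
    by move=> _ [x _ <-]; left.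
  by move: mP => [].
have Hc0 : (0 <= label_entropy mu c)%E.
  by apply: esum_ge0 => n _; exact: entropy_term_mu_ge0.
have Hfin : label_entropy mu c \is a fin_num by rewrite ge0_fin_numE.
pose h := fine (label_entropy mu c).
have h0 : 0 <= h by exact: fine_ge0.
apply/lee_addgt0Pr => eps eps0; rewrite add0e.
have e20 : 0 < eps / 2 by rewrite divr_gt0.
have [eta [n0 [delta [eta01 delta0 small]]]] := step_error_small mc Hc e20.
(* With this many elements the initial entropy [h] contributes at most [eps / 2] per element, and
   each step adds at most [eps / 2]. *)
have [W0 W0card W0P] := reca (fun n => c @^-1` [set n]) n0 delta
  (Num.truncn (h / (eps / 2))).+1 mc delta0.
(* The identity has to be present, since all other letters are guessed from its label. *)
pose W := (1%g |` W0)%fset.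
have W0W : (#|` W0| <= #|` W|)%N by apply: fsubset_leq_card; exact: fsubsetU1.
have W_gt : h / (eps / 2) < #|` W|%:R.
  rewrite (lt_le_trans (truncnS_gt _))// ler_nat.
  exact: leq_trans W0W.
have cardW0 : 0 < (#|` W|%:R : R) by rewrite (le_lt_trans _ W_gt)// divr_ge0// ltW.
pose s := rem 1%g (enum_fset W).
have sW : rcons s 1%g =i W.
  move=> g; rewrite mem_rcons.
  by rewrite -(perm_mem (perm_to_rem (_ : 1%g \in enum_fset W)))// fset1U1.
have size_s : (size s <= #|` W|)%N by rewrite size_rem ?fset1U1// leq_pred.
have err w : w \in s -> ((- ln (1 - eta))%:E + \esum_(n in [set: nat])
      ((- ln eta - ln (law mu c n))%:E *
        mu ((c \o act a w) @^-1` [set n] `&` [set x | c (act a 1%g x) <> n])) <=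
      (eps / 2)%:E)%E.
  move=> ws; have wW0 : w \in W0.
    have : w \in W by rewrite -sW mem_rcons inE ws orbT.
    rewrite in_fset1U => /orP[/eqP w1|//].
    by move: ws; rewrite w1 mem_rem_uniqF// fset_uniq.
  have mw n : measurable ((c \o act a w) @^-1` [set n]).
    exact: mlabel_comp (act_measurable a w) mc _.
  have m1 n : measurable [set x | c (act a 1%g x) <> n].
    exact/(@act_preimage_measurable a 1%g (~` (c @^-1` [set n])))/measurableC.
  apply: small => n.
    rewrite measure_ge0 /= -(act_mp a w (mc n)) le_measure ?inE//.
      by apply: measurableI.
    by rewrite -comp_preimage.
  move=> nn0; apply: le_lt_trans (W0P w n wW0 nn0).
  have mm : measurable (act a w @^-1` (c @^-1` [set n]) `\` (c @^-1` [set n])).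
    by apply: measurableD; [exact: act_preimage_measurable|exact: mc].
  (* The representative [act a 1%g] is the identity only almost everywhere, so the two sets agree up
     to a null set. *)
  apply: (@le_trans _ _ (mu (act a w @^-1` (c @^-1` [set n]) `\` (c @^-1` [set n])))).
    rewrite le_eqVlt; apply/orP; left; apply/eqP; apply: ae_measure_eq => //.
      exact: measurableI.
    by apply: filterS (act1 a) => x /= ->.
  rewrite le_measure ?inE//; last exact: subsetUl.
  by apply: measurableY => //; exact: act_preimage_measurable.
apply: ge_ereal_inf; exists ((#|` W|%:R)^-1%:E * entropy mu (refinement a P W))%E.
  by exists W => //; apply/fset0Pn; exists 1%g; rewrite fset1U1.
rewrite muleC lee_pdivrMr//.
apply: le_trans (refinement_entropy_le a sW mc Pc) _.
apply: le_trans (names_entropy_le mc eta01 err) _.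
rewrite sumEFin big_const_seq count_predT iter_addr addr0 -(fineK Hfin) -/h.
rewrite -EFinD -EFinM lee_fin.
have : h <= eps / 2 * #|` W|%:R by rewrite mulrC -ler_pdivrMr// ltW.
have : (eps / 2) *+ size s <= eps / 2 * #|` W|%:R.
  by rewrite -mulr_natr ler_wpM2l ?ler_nat// ltW.
by lra.
Qed.

Lemma recurrent_naive_entropy a : recurrent a -> naive_entropy a = 0%E.
Proof.
move=> reca; apply/eqP; rewrite eq_le; apply/andP; split.
  apply: ge_ereal_sup => _ [P [mP HP] <-]; exact: recurrent_naive_entropy_of.
(* The one-cell partition shows that the supremum is nonnegative; cells of a partition must be
   nonempty. *)
have mu_neq0 : [set: X] !=set0.
  apply/set0P/eqP => X0; have := @probability_setT _ _ _ mu.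
  by rewrite X0 measure0 => /eqP; rewrite eq_sym onee_eq0.
have mT : measurable_partition [set [set: X]].
  split; [exact: countable1|by move=> _ ->|split].
  - by rewrite /cover bigcup_set1.
  - by move=> _ _ -> ->.
  - by move=> _ ->.
apply: le_trans (ereal_sup_ubound _); last first.
  exists [set [set: X]] => //; split => //.
  by rewrite /entropy esum_set1 ?entropy_term_mu_ge0//; exact: ltry.
apply: le_ereal_inf_tmp => _ [W _ <-]; rewrite mule_ge0 ?lee_fin//.
apply: esum_ge0 => _ [A PA <-]; apply: entropy_term_mu_ge0.
apply: fin_bigcap_measurable => // w /= /PA ->.
exact: act_preimage_measurable.
Qed.

End NaiveEntropy.

Lemma near_seq (T : eqType) (I : Type) (F : set_system I) {FF : Filter F}
    (s : seq T) (P : T -> I -> Prop) :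
  (forall t, t \in s -> \forall i \near F, P t i) ->
  \forall i \near F, forall t, t \in s -> P t i.
Proof.
elim: s => [|t s IH] sP; first by near=> i.
have Pt := sP t (mem_head _ _).
have Ps : \forall i \near F, forall u, u \in s -> P u i.
  by apply: IH => u us; apply: sP; rewrite inE us orbT.
by apply: filterS2 Pt Ps => i Pti Psi u; rewrite inE => /orP[/eqP ->//|]; exact: Psi.
Unshelve. all: by end_near. Qed.

(** * The space of actions *)

Section AutExtra.
Context d (X : measurableType d) (R : realType) (mu : probability X R).
Implicit Types (S T : Aut mu) (A : set X).

Lemma Aut_fun_measurable S : measurable_fun setT (Aut_fun S).
Proof. exact: mp_fun_measurable. Qed.

Lemma Aut_fun_preimage_measurable S A :
  measurable A -> measurable (Aut_fun S @^-1` A).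
Proof. by move=> mA; rewrite -[_ @^-1` _]setTI; exact: Aut_fun_measurable. Qed.

(** An image under [S] is a preimage under its inverse, which agrees almost everywhere with the
    representative chosen for [Aut_inv S]. *)
Lemma Aut_dist_preimage A S T : measurable A ->
  Aut_dist A S T =
    mu (Aut_fun (Aut_inv S) @^-1` A `+` Aut_fun (Aut_inv T) @^-1` A).
Proof.
move=> mA; rewrite /Aut_dist; apply: ae_measure_eq.
- by apply: measurableY; exact: Aut_fun_image_measurable.
- by apply: measurableY; exact: Aut_fun_preimage_measurable.
have h1 := Aut_fun_pi (mp_bij_inv (repr S)).
have h2 := Aut_fun_pi (mp_bij_inv (repr T)).
apply: (filterS2 _ _ h1 h2) => x Sx Tx.
by rewrite !Aut_fun_image /setY /= Sx Tx.
Qed.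

Lemma Aut_dist1 A S : measurable A ->
  Aut_dist A S (Aut_one mu) = mu (Aut_fun S @^-1` A `+` A).
Proof.
move=> mA; rewrite /Aut_dist -(mp_fun_mp (repr S)); last first.
  by apply: measurableY; exact: Aut_fun_image_measurable.
apply: ae_measure_eq.
- have mY : measurable (Aut_fun S @` A `+` Aut_fun (Aut_one mu) @` A).
    by apply: measurableY; exact: Aut_fun_image_measurable.
  exact: (Aut_fun_preimage_measurable S mY).
- by apply: measurableY => //; exact: Aut_fun_preimage_measurable.
have one_inv : \forall x \ae mu, mp_inv (repr (Aut_one mu)) x = x.
  have : Aut_inv (Aut_one mu) = Aut_one mu.
    by rewrite -[LHS]Aut_mulg1 Aut_mulVg.
  move=> inv1; have := Aut_fun_pi (mp_bij_inv (repr (Aut_one mu))).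
  rewrite -/(Aut_inv _) inv1 => h.
  by apply: filterS2 h (Aut_fun_one mu) => x /= <-.
have := ae_mp_preimage (repr S) one_inv.
apply: filterS => x; rewrite !Aut_fun_image /setY /= => ->.
rewrite mp_funK; rewrite /Aut_fun; tauto.
Qed.

Fixpoint orbit_word (S T : X -> X) (w : seq bool) : X -> X :=
  if w is b :: w then (if b then S else T) \o orbit_word S T w else id.

(* Restrict [S] to the points all of whose images under words in [S] and [T]
   satisfy the two cancellation laws, and extend it by the identity. *)
Lemma Aut_of_ae_inverse (S T : X -> X) :
  measurable_fun setT S -> measurable_fun setT T ->
  (forall A, measurable A -> mu (S @^-1` A) = mu A) ->
  (\forall x \ae mu, T (S x) = x) -> (\forall x \ae mu, S (T x) = x) ->
  exists U : Aut mu, \forall x \ae mu, Aut_fun U x = S x.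
Proof.
move=> mS mT Smu TS ST.
have Tmu A : measurable A -> mu (T @^-1` A) = mu A.
  move=> mA; have mTA : measurable (T @^-1` A) by rewrite -[_ @^-1` _]setTI; exact: mT.
  rewrite -Smu//; apply: ae_measure_eq => //.
    by rewrite -[_ @^-1` _]setTI; exact: mS.
  by apply: filterS TS => x /= ->.
have [N [mN N0 NP]] : mu.-negligible (~` [set x | T (S x) = x /\ S (T x) = x]).
  by apply: filterS2 TS ST.
pose wd := orbit_word S T.
have mwd w : measurable_fun setT (wd w).
  elim: w => [|b w IH] /=; first exact: measurable_id.
  by apply: measurableT_comp => //; case: b.
have mwdN w : measurable (wd w @^-1` N).
  by rewrite -[_ @^-1` _]setTI; exact: mwd.
have wd0 w : forall B, measurable B -> mu B = 0%E -> mu (wd w @^-1` B) = 0%E.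
  elim: w => [//|b w IH] B mB B0; rewrite /wd /= comp_preimage; apply: IH.
    by case: b; rewrite -[_ @^-1` _]setTI; [exact: mS|exact: mT].
  by case: b; rewrite ?Smu ?Tmu.
(* There are countably many words, so the union [M] is null; its complement is stable under [S] and
   [T]. *)
pose B n := if @choice.unpickle (seq bool) n is Some w then wd w @^-1` N else set0.
have mB n : measurable (B n) by rewrite /B; case: choice.unpickle.
pose M := \bigcup_n B n.
have mM : measurable M by exact: bigcup_measurable.
have M0 : \forall x \ae mu, ~ M x.
  have : mu.-negligible M.
    apply: negligible_bigcup => n; apply/negligibleP => //.
    by rewrite /B; case: choice.unpickle => [w|]; [exact: wd0|exact: measure0].
  by apply: negligibleS => x /contrapT.
have MP x : ~ M x <-> forall w, ~ N (wd w x).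
  split=> [nM w Nw|nN [n _]]; last by rewrite /B; case: choice.unpickle => // w; exact: nN.
  by apply: nM; exists (choice.pickle w) => //; rewrite /B choice.pickleK.
have wd_rcons b w x : wd (rcons w b) x = wd w ((if b then S else T) x).
  by rewrite /wd; elim: w => //= c w ->.
have MS x : ~ M x -> ~ M (S x).
  by rewrite !MP => nN w; have := nN (rcons w true); rewrite wd_rcons.
have MT x : ~ M x -> ~ M (T x).
  by rewrite !MP => nN w; have := nN (rcons w false); rewrite wd_rcons.
have MK x : ~ M x -> T (S x) = x /\ S (T x) = x.
  by move=> /MP/(_ [::]) /= nN; apply: contrapT => h; apply: nN; exact: NP.
pose ext (f : X -> X) x := if x \in M then x else f x.
have extM f x : M x -> ext f x = x by move=> Mx; rewrite /ext mem_set.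
have extN f x : ~ M x -> ext f x = f x by move=> Mx; rewrite /ext memNset.
have extK f g : (forall x, ~ M x -> ~ M (f x)) -> (forall x, ~ M x -> g (f x) = x) ->
    cancel (ext f) (ext g).
  move=> Mf gf x; have [Mx|Mx] := pselect (M x); first by rewrite extM ?extM.
  rewrite (extN f x Mx) (extN g) ?gf//; exact: Mf.
have mext f : measurable_fun setT f -> measurable_fun setT (ext f).
  move=> mf _ A mA; rewrite setTI.
  have -> : ext f @^-1` A = (M `&` A) `|` (~` M `&` f @^-1` A).
    apply/seteqP; split => x /=.
      by have [Mx|Mx] := pselect (M x); [rewrite extM//; left|rewrite extN//; right].
    by move=> [[Mx Ax]|[Mx Ax]]; [rewrite extM|rewrite extN].
  apply: measurableU; apply: measurableI => //; first exact: measurableC.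
  by rewrite -[_ @^-1` _]setTI; exact: mf.
have extS_ae : \forall x \ae mu, ext S x = S x by apply: filterS M0 => x /extN.
have extSmu A : measurable A -> mu (ext S @^-1` A) = mu A.
  move=> mA; rewrite -(Smu A mA); apply: ae_measure_eq.
  - by rewrite -[_ @^-1` _]setTI; exact: mext.
  - by rewrite -[_ @^-1` _]setTI; exact: mS.
  - by apply: filterS extS_ae => x /= ->.
pose U := @MpBij _ _ _ mu (ext S) (ext T) (extK _ _ MS (fun x h => (MK x h).1))
  (extK _ _ MT (fun x h => (MK x h).2)) (mext _ mS) (mext _ mT) extSmu.
exists (\pi_(Aut mu)%qT U).
by apply: (filterS2 _ _ (Aut_fun_pi U) extS_ae) => x /= ->.
Qed.

End AutExtra.

Section ActionsTopology.
Context (G : groupType) d (X : measurableType d) (R : realType)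
  (mu : probability X R).
Implicit Types a b : actions G mu.

Definition aut_of a (g : G) : Aut mu := (a : Multiplicative.type _ _) g.

Lemma aut_ofV a g : aut_of a g^-1%g = Aut_inv (aut_of a g).
Proof.
have E : (aut_of a g * aut_of a g^-1 = aut_of a g * (aut_of a g)^-1)%g.
  by rewrite /aut_of -gmulfM !mulgV action1.
exact: mulgI E.
Qed.

Lemma aut_of_eval_continuous g : continuous (fun a => aut_of a g).
Proof.
move=> a; have c1 := @initial_continuous _ _ (@actions_ptws G _ X R mu) a.
have c2 := @proj_continuous G (fun=> Aut mu) g (actions_ptws a).
exact: cvg_comp c1 c2.
Qed.

Lemma near_aut_of a g A (e : R) : measurable A -> 0 < e ->
  \forall b \near a, (Aut_dist A (aut_of b g) (aut_of a g) < e%:E)%E.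
Proof.
move=> mA e0; have /Aut_cvgP cvg_a := @aut_of_eval_continuous g a.
have FF : Filter ((fun b => aut_of b g) @ a) by apply: fmap_filter; exact: nbhs_filter.
exact: (cvg_a FF A e mA e0).
Qed.

Lemma initial_cvg (S : choiceType) (T : topologicalType) (f : S -> T)
    (F : set_system S) (s : S) : Filter F ->
  f x @[x --> F] --> f s -> F --> (s : initial_topology f).
Proof.
move=> FF fF A; rewrite nbhsE => -[_ [[B oB <-] Bs] BA].
by apply: filterS BA _; apply: fF; exact: open_nbhs_nbhs.
Qed.

Lemma actions_cvg (F : set_system (actions G mu)) a : Filter F ->
  (forall g A (e : R), measurable A -> 0 < e ->
     \forall b \near F, (Aut_dist A (aut_of b g) (aut_of a g) < e%:E)%E) ->
  F --> a.
Proof.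
move=> FF Fa; apply: initial_cvg; apply/cvg_sup => g; apply: initial_cvg.
by apply/Aut_cvgP => A e mA e0; exact: Fa.
Qed.

Lemma dense_actions (D : set (actions G mu)) :
  (forall a, exists b : nat -> actions G mu, (forall n, D (b n)) /\
     forall g A (e : R), measurable A -> 0 < e ->
       \forall n \near \oo, (mu (act (b n) g @^-1` A `+` act a g @^-1` A) < e%:E)%E) ->
  dense D.
Proof.
move=> Da O [a Oa] oO; have [b [Db ba]] := Da a.
have bcvg : b @ \oo --> a.
  (* The topology compares images of sets, and an image under [g] is a preimage under [g^-1]. *)
  apply: actions_cvg => g A e mA e0; apply: filterS (ba g^-1%g A e mA e0) => n.
  by rewrite /= Aut_dist_preimage// -!aut_ofV.
have [n _ /(_ n (leqnn n)) On] : \forall n \near \oo, O (b n).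
  by apply: bcvg; exact: open_nbhs_nbhs.
by exists (b n).
Qed.

(* For a generating sequence [C], these are the actions returning infinitely
   often to each neighbourhood of the identity. *)
Definition recurrence_set (C : nat -> set X) : set (actions G mu) :=
  \bigcap_n [set a | exists2 W : {fset G}, (n <= #|` W|)%N &
    forall w, w \in W -> forall i, i \in iota 0 n ->
      (Aut_dist (C i) (aut_of a w) (Aut_one mu) < (n.+1%:R^-1)%:E)%E].

(** For fixed [n] a set [W] that works for [a] works for all nearby actions, since it is subject to
    finitely many strict inequalities. *)
Lemma recurrence_set_Gdelta C : (forall i, measurable (C i)) ->
  Gdelta (recurrence_set C).
Proof.
move=> mC; exists (fun n => [set a | exists2 W : {fset G}, (n <= #|` W|)%N &
    forall w, w \in W -> forall i, i \in iota 0 n ->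
      (Aut_dist (C i) (aut_of a w) (Aut_one mu) < (n.+1%:R^-1)%:E)%E]) => // n.
rewrite openE => a [W nW aW].
suff : \forall b \near a, forall w, w \in enum_fset W -> forall i, i \in iota 0 n ->
      (Aut_dist (C i) (aut_of b w) (Aut_one mu) < (n.+1%:R^-1)%:E)%E.
  by apply: filterS => b bW; exists W.
have FFa : Filter (nbhs a) := nbhs_filter a.
apply: (@near_seq _ _ _ FFa) => w wW; apply: (@near_seq _ _ _ FFa) => i ni.
pose e := n.+1%:R^-1 - fine (Aut_dist (C i) (aut_of a w) (Aut_one mu)).
have e0 : 0 < e.
  by rewrite subr_gt0 -lte_fin fineK ?Aut_dist_fin//; exact: aW.
apply: filterS (near_aut_of a w (mC i) e0) => b.
rewrite /e EFinB fineK ?Aut_dist_fin// => h.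
apply: le_lt_trans (Aut_dist_triangle _ (aut_of a w) _ (mC i)) _.
by rewrite -lteBrDr// Aut_dist_fin.
Qed.

Lemma recurrence_setP C a : (forall i, measurable (C i)) ->
  (forall n, exists2 W : {fset G}, (n <= #|` W|)%N & forall w i, w \in W ->
     (i < n)%N -> (mu (act a w @^-1` C i `+` C i) < (n.+1%:R^-1)%:E)%E) ->
  recurrence_set C a.
Proof.
move=> mC aC n _; have [W nW WP] := aC n; exists W => // w wW i.
by rewrite mem_iota add0n => /= ni; rewrite Aut_dist1//; exact: WP.
Qed.

Lemma recurrence_set_recurrent C a : (forall i, measurable (C i)) ->
  (forall A, measurable A -> approximable mu C A) ->
  recurrence_set C a -> recurrent a.
Proof.
move=> mC appC aC.
have /choice[W WP] : forall n, exists W : {fset G}, (n <= #|` W|)%N /\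
    forall w i, w \in W -> (i < n)%N -> (mu (act a w @^-1` C i `+` C i) < (n.+1%:R^-1)%:E)%E.
  move=> n; have [W nW WP] := aC n I; exists W; split => // w i wW ni.
  by rewrite -Aut_dist1//; apply: WP; rewrite // mem_iota.
(* The filter of pairs [(n, w)] with [w] in [W n] and [n] tending to infinity. Along it every [C j]
   is nearly fixed, hence so is every measurable set. *)
pose F : set_system (nat * G)%type :=
  [set S | exists n0, forall n w, (n0 <= n)%N -> w \in W n -> S (n, w)].
have FF : Filter F.
  split; first by exists 0%N.
    move=> P Q [m mP] [n nQ]; exists (maxn m n) => k w; rewrite geq_max => /andP[mk nk] wk.
    by split; [exact: mP|exact: nQ].
  by move=> P Q PQ [m mP]; exists m => k w mk wk; apply: PQ; exact: mP.
have nf A : measurable A -> nearly_fixed mu F (fun p => act a p.2) A.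
  apply: (@nearly_fixed_approximable _ _ _ _ _ _ _ nat C) => //.
  - by move=> i; exact: act_measurable.
  - by move=> i B mB; exact: act_mp.
  move=> j e e0; exists (maxn j.+1 (Num.truncn e^-1)) => n w.
  rewrite geq_max => /andP[jn en] wn.
  apply: lt_le_trans ((WP n).2 w j wn jn) _.
  rewrite lee_fin invf_ple ?posrE//; apply: le_trans (ltW (truncnS_gt _)) _.
  by rewrite ler_nat ltnS.
move=> B n0 delta N mB delta0.
have : \forall p \near F, forall i, i \in iota 0 n0 ->
    (mu (act a p.2 @^-1` B i `+` B i) < delta%:E)%E.
  by apply: near_seq => i _; exact: nf.
move=> [m mP]; exists (W (maxn m N)).
  by apply: leq_trans (WP _).1; rewrite leq_maxr.
move=> w n wW nn0; apply: (mP _ _ _ wW); first exact: leq_maxl.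
by rewrite mem_iota.
Qed.

End ActionsTopology.

(** * Profinite actions *)

Section Generators.

Lemma generated_preimage (Z Y : Type) (S : set (set Z)) (h : Z -> Y)
    (D : set (set Y)) : sigma_algebra setT S ->
  (forall A, D A -> S (h @^-1` A)) -> forall A, <<s D >> A -> S (h @^-1` A).
Proof.
move=> [S0 SC SU] DS; apply: smallest_sub => //; split => //.
- by move=> A SA; rewrite setTD; have := SC _ SA; rewrite setTD.
- by move=> A SA; rewrite /= preimage_bigcup; exact: SU.
Qed.

Variable R : realType.

(** Half-lines with rational endpoint, indexed through a coding of the rationals; a number that
    codes none stands for the endpoint 0. *)
Definition rational_ray (n : nat) : set (measurableTypeR R) :=
  `]ratr (odflt 0 (@choice.unpickle rat n)), +oo[%classic.

Lemma rational_ray_generates (B : set (measurableTypeR R)) :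
  measurable B -> <<s range rational_ray >> B.
Proof.
move=> mB; have {mB} : (@RGenOInfty.G R).-sigma.-measurable B.
  by rewrite -RGenOInfty.measurableE.
apply: smallest_sub; first exact: smallest_sigma_algebra.
move=> _ [x ->]; pose r n : R := ratr (odflt 0 (@choice.unpickle rat n)).
have -> : `]x, +oo[%classic = \bigcup_n (if x <= r n then rational_ray n else set0).
  apply/seteqP; split => y /=; rewrite in_itv /= andbT.
    move=> xy; have [q] := rat_in_itvoo xy; rewrite in_itv /= => /andP[xq qy].
    exists (choice.pickle q) => //; rewrite /r choice.pickleK /= ltW//.
    by rewrite /rational_ray choice.pickleK /= in_itv /= andbT.
  move=> [n _]; case: ifPn => // xr; rewrite /rational_ray /= in_itv /= andbT.
  exact: le_lt_trans.
apply: sigma_algebra_bigcup => n; case: ifPn => _; last exact: sigma_algebra0.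
by apply: sub_sigma_algebra; exists n.
Qed.

Context d (X : measurableType d) (mu : probability X R).

(** With [g] the inverse of [f], the set [A] agrees almost everywhere with the preimage under [f] of
    [g^-1 A], to which [approximable_sigma] applies. *)
Lemma approximable_iso d' (Z : measurableType d') (nu : {measure set Z -> \bar R})
    (f : X -> Z) (I : Type) (C : I -> set Z) (i0 : I) :
  measure_iso mu nu f -> (forall i, measurable (C i)) ->
  (forall B, measurable B -> <<s range C >> B) ->
  (forall i, measurable (f @^-1` C i)) /\
  forall A, measurable A -> approximable mu (fun i => f @^-1` C i) A.
Proof.
move=> [mf _ [g [mg gf _]]] mC genC.
have mfC i : measurable (f @^-1` C i) by rewrite -[_ @^-1` _]setTI; exact: mf.
split => // A mA e e0.
have mgA : measurable (g @^-1` A) by rewrite -[_ @^-1` _]setTI; exact: mg.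
have [mfgA appA] := approximable_sigma mu i0 mfC (genC _ mgA).
have [b hb] := appA e e0; exists b; apply: le_lt_trans hb.
have mb : measurable (bset (fun i => f @^-1` C i) b) by exact: measurable_bset.
rewrite le_eqVlt; apply/orP; left; apply/eqP; apply: ae_measure_eq; try exact: measurableY.
by apply: filterS gf => x /= gfx; rewrite /setY /= gfx.
Qed.

Lemma lebesgue_space_generators : lebesgue_space mu ->
  exists C : nat -> set X, (forall i, measurable (C i)) /\
    forall A, measurable A -> approximable mu C A.
Proof.
move=> [f fiso].
have mray i : measurable (rational_ray i) by exact: measurable_itv.
have [mC appC] := approximable_iso 0%N fiso mray rational_ray_generates.
by exists (fun i => f @^-1` rational_ray i).
Qed.

End Generators.

(** Pigeonhole: some fibre of [h] is infinite, and [W] is a finite part of it translated back by one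
    of its points [g0]. *)
Lemma infinite_repetition (G : groupType) (U : Type) (h : G -> U) (n : nat) :
  infinite_set [set: G] -> finite_set (range h) ->
  exists (g0 : G) (W : {fset G}), (n <= #|` W|)%N /\
    forall w, w \in W -> h (g0 * w)%g = h g0.
Proof.
move=> G_infinite hfin; have [u uinf] : exists u, infinite_set (h @^-1` [set u]).
  apply: contrapT => /forallNP fin; apply: G_infinite.
  have -> : [set: G] = \bigcup_(u in range h) (h @^-1` [set u]).
    by apply/seteqP; split => g // _; exists (h g) => //; exists g.
  by apply: bigcup_finite => // u _; apply: contrapT; exact: fin.
have [W0 W0u nW0] := infinite_set_fset n.+1 uinf.
have [g0 g0W] : exists g0, g0 \in W0.
  by apply/fset0Pn; rewrite -cardfs_gt0; exact: leq_trans nW0.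
exists g0, [fset (g0^-1 * g)%g | g in W0]%fset; split.
  rewrite card_imfset /=; last exact: mulgI.
  exact: ltnW.
move=> w /imfsetP[g /= gW ->]; rewrite mulVKg.
by rewrite (W0u g gW) (W0u g0 g0W).
Qed.

Section Profinite.
Variable G : groupType.
Local Open Scope group_scope.
Implicit Types (N M : fin_normal G) (g h : G) (x y : profinite G).

Lemma fin_normal1 N : (N : set G) 1.
Proof. by have [/set_mem] := fin_normal_group N. Qed.

Lemma fin_normalMV N g h : (N : set G) g -> (N : set G) h -> (N : set G) (g^-1 * h).
Proof.
move=> Ng Nh; have [_ NB] := fin_normal_group N.
have NV k : (N : set G) k -> (N : set G) k^-1.
  move=> Nk; have /set_mem := NB 1 k (mem_set (fin_normal1 N)) (mem_set Nk).
  by rewrite div1g.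
have /set_mem := NB g^-1 h^-1 (mem_set (NV _ Ng)) (mem_set (NV _ Nh)).
by rewrite invgK.
Qed.

Lemma fin_normalV N g : (N : set G) g -> (N : set G) g^-1.
Proof. by move=> Ng; rewrite -[_^-1]mulg1; apply: fin_normalMV => //; exact: fin_normal1. Qed.

Lemma fin_normalM N g h : (N : set G) g -> (N : set G) h -> (N : set G) (g * h).
Proof. by move=> /fin_normalV Ng Nh; rewrite -[g]invgK; exact: fin_normalMV. Qed.

Lemma lcoset_ofP N g h : lcoset_of N g h <-> (N : set G) (g^-1 * h).
Proof.
split=> [[n Nn <-]|Nh]; first by rewrite mulKg.
by exists (g^-1 * h); rewrite ?mulVKg.
Qed.

Lemma lcoset_of_refl N g : lcoset_of N g g.
Proof. by apply/lcoset_ofP; rewrite mulVg; exact: fin_normal1. Qed.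

Lemma lcoset_of_eqP N g h : lcoset_of N g = lcoset_of N h <-> (N : set G) (g^-1 * h).
Proof.
split=> [gh|Ngh]; first by apply/lcoset_ofP; rewrite gh; exact: lcoset_of_refl.
apply/seteqP; split => k /lcoset_ofP Nk; apply/lcoset_ofP.
  have -> : h^-1 * k = (g^-1 * h)^-1 * (g^-1 * k) by rewrite invgM invgK mulgA mulgK.
  exact: fin_normalMV.
have -> : g^-1 * k = (g^-1 * h) * (h^-1 * k) by rewrite mulgA mulgK.
exact: fin_normalM.
Qed.

Lemma lcoset_of_abs N g h : (N : set G) g -> lcoset_of N (g * h) = lcoset_of N h.
Proof.
move=> Ng; apply/esym/lcoset_of_eqP; rewrite mulgA.
by have := @fin_normal_normal _ N h^-1 g Ng; rewrite invgK.
Qed.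

Lemma fin_normal_ext N M : (N : set G) = M -> N = M.
Proof.
case: N M => [N NG NN NI] [M MG MN MI] /= NM; subst M.
by congr FinNormal; exact: Prop_irrelevance.
Qed.

Lemma profinite_ext x y : (forall N, x N = y N) -> x = y.
Proof.
case: x y => [x xc xp] [y yc yp] /= xy; have {}xy : x = y by exact: funext.
by subst y; congr Profinite; exact: Prop_irrelevance.
Qed.

Lemma prof_mul_injE g x N h : x N = lcoset_of N h ->
  prof_mul (prof_inj g) x N = lcoset_of N (g * h).
Proof. by move=> /= ->; exact: lcoset_of_mul. Qed.

Lemma prof_mul_injK g : cancel (prof_mul (prof_inj g)) (prof_mul (prof_inj g^-1)).
Proof.
move=> x; apply: profinite_ext => N; have [h xh] := prof_coset x N.
by rewrite (prof_mul_injE _ (prof_mul_injE g xh)) mulKg xh.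
Qed.

Lemma finite_indexI N M : finite_index ((N : set G) `&` M).
Proof.
rewrite /finite_index.
have -> : lcoset_of ((N : set G) `&` M) = fun g => lcoset_of N g `&` lcoset_of M g.
  apply/funext => g; apply/seteqP; split => [_ [n [Nn Mn] <-]|k []].
    by split; exists n.
  by move=> /lcoset_ofP Nk /lcoset_ofP Mk; exists (g^-1 * k); rewrite ?mulVKg.
by apply: finite_image11; exact: fin_normal_index.
Qed.

Definition fin_normalI N M : fin_normal G.
Proof.
exists ((N : set G) `&` M).
- split; first by apply: mem_set; split; exact: fin_normal1.
  move=> g h /set_mem[Ng Mg] /set_mem[Nh Mh]; apply: mem_set.
  by split; apply: fin_normalM => //; exact: fin_normalV.
- by move=> g n [Nn Mn]; split; exact: fin_normal_normal.
- exact: finite_indexI.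
Defined.

Definition coset_index N := #|` fset_set (range (lcoset_of N))|.

Lemma coset_index_gt0 N : (0 < coset_index N)%N.
Proof.
rewrite cardfs_gt0; apply/fset0Pn; exists (lcoset_of N 1).
by rewrite in_fset_set; [apply: mem_set; exists 1|exact: fin_normal_index].
Qed.

Lemma coset_index_fin_normalI N M :
  (coset_index (fin_normalI N M) <= coset_index N * coset_index M)%N.
Proof.
have FN (L : fin_normal G) : finite_set (range (lcoset_of L)) by exact: fin_normal_index.
pose A := fset_set (range (lcoset_of N)); pose B := fset_set (range (lcoset_of M)).
rewrite -(size_allpairs (fun C D => C `&` D) A B).
apply: uniq_leq_size (fset_uniq _) _ => C.
rewrite in_fset_set// => /set_mem[g _ <-]; apply/allpairsP => /=.
exists (lcoset_of N g, lcoset_of M g) => /=; split.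
- by rewrite in_fset_set//; apply: mem_set; exists g.
- by rewrite in_fset_set//; apply: mem_set; exists g.
apply/seteqP; split => [_ [n [Nn Mn] <-]|k []].
  by split; exists n.
by move=> /lcoset_ofP Nk /lcoset_ofP Mk; exists (g^-1 * k); rewrite ?mulVKg.
Qed.

End Profinite.

Section Haar.
Variables (G : groupType) (R : realType) (eta : probability (prof_borel G) R).
Hypothesis eta_haar : is_haar eta.
Implicit Types N : fin_normal G.

Definition cylinder N (g : G) : set (profinite G) := [set x | x N = lcoset_of N g].

Lemma cylinder_sub N (M : fin_normal G) g :
  (N : set G) `<=` M -> cylinder N g `<=` cylinder M g.
Proof.
move=> NM x xN; have [h xh] := prof_coset x M.
rewrite /cylinder /= xh; apply/lcoset_of_eqP/lcoset_ofP; rewrite -xh.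
by apply: (prof_compat NM); rewrite xN; exact: lcoset_of_refl.
Qed.

Lemma measurable_cylinder N g : measurable (cylinder N g : set (prof_borel G)).
Proof.
apply: sub_sigma_algebra; exists [set cylinder N g]; last by rewrite bigcup_set1.
move=> _ ->; exists [fset cylinder N g]%fset; last by rewrite set_fset1 bigcap_set1.
by move=> U /fset1P ->; apply/mem_set; exists N, (lcoset_of N g).
Qed.

Lemma haar_cylinder N g : eta (cylinder N g) = eta (cylinder N 1%g).
Proof.
rewrite -[RHS](eta_haar (prof_inj g)); last exact: measurable_cylinder.
congr (eta _); apply/seteqP; split => [x xg|_ [x x1 <-]].
  exists (prof_mul (prof_inj g^-1%g) x).
    by have := prof_mul_injE g^-1%g xg; rewrite mulVg.
  by rewrite -{1}[g]invgK prof_mul_injK.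
by have := prof_mul_injE g x1; rewrite mulg1.
Qed.

(** The cylinders of the cosets of [N] cover the completion and have equal Haar measure. *)
Lemma haar_cylinder_ge N g : (1%:E <= (coset_index N)%:R%:E * eta (cylinder N g))%E.
Proof.
have FN : finite_set (range (lcoset_of N)) by exact: fin_normal_index.
pose A := fset_set (range (lcoset_of N)).
pose F C : set (prof_borel G) := [set x : profinite G | x N = C].
have FE C : C \in A -> exists h, F C = cylinder N h.
  by rewrite in_fset_set// => /set_mem[h _ <-]; exists h.
rewrite -(@probability_setT _ _ _ eta).
have -> : [set: prof_borel G] = \big[setU/set0]_(C <- A) F C.
  apply/seteqP; split => // x _; have [h xh] := prof_coset x N.
  rewrite -bigcup_seq; exists (lcoset_of N h) => //=.
  by rewrite in_fset_set//; apply: mem_set; exists h.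
have sub (s : seq (set G)) : {subset s <= A} ->
    measurable (\big[setU/set0]_(C <- s) F C) /\
    (eta (\big[setU/set0]_(C <- s) F C) <= (size s)%:R%:E * eta (cylinder N g))%E.
  elim: s => [|C s IH] sA; first by rewrite !big_nil measure0 mul0e.
  have [h FCh] := FE C (sA C (mem_head _ _)).
  have [ms hs] := IH (fun D Ds => sA D (mem_behead (s := C :: s) Ds)).
  have mC : measurable (F C) by rewrite FCh; exact: measurable_cylinder.
  rewrite !big_cons; split; first exact: measurableU.
  apply: le_trans (measureU2 _ mC ms) _.
  rewrite -[size (C :: s)]/(size s).+1 -natr1 EFinD ge0_muleDl// addeC mul1e leeD//.
  rewrite FCh le_eqVlt; apply/orP; left; apply/eqP.
  exact: etrans (haar_cylinder N h) (esym (haar_cylinder N g)).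
by have [_] := sub A (fun _ => id).
Qed.

End Haar.

(** Generic trees over [nat] are countable, so this embedding gives Boolean expressions a numerical
    code. *)
Fixpoint bexp_tree (b : bexp nat) : GenTree.tree nat :=
  match b with
  | BLeaf n => GenTree.Leaf n
  | BNor b1 b2 => GenTree.Node 0 [:: bexp_tree b1; bexp_tree b2]
  end.

Lemma bexp_tree_inj : injective bexp_tree.
Proof.
elim=> [m|a IHa b IHb] [n|c d] //=; first by move=> [->].
by move=> [/IHa -> /IHb ->].
Qed.

Section ProfiniteFactor.
Context (G : groupType) d (X : measurableType d) (R : realType)
  (mu : probability X R) (eta : probability (prof_borel G) R).
Variable f : X -> prof_borel G * measurableTypeR R.
Hypothesis eta_haar : is_haar eta.
Hypothesis mf : measurable_fun setT f.
Hypothesis f_mu : forall B, measurable B ->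
  (eta \x unit_lebesgue R)%E B = mu (f @^-1` B).
Variable C : nat -> set X.
Hypothesis mC : forall i, measurable (C i).
Hypothesis appC : forall A, measurable A -> approximable mu C A.

Definition pullback (N : fin_normal G) (g : G) : set X :=
  f @^-1` (cylinder N g `*` setT).

Lemma measurable_pullback N g : measurable (pullback N g).
Proof.
rewrite -[pullback _ _]setTI; apply: mf => //.
by apply: measurableX => //; exact: measurable_cylinder.
Qed.

Lemma mu_pullback N g : mu (pullback N g) = eta (cylinder N g).
Proof.
rewrite -f_mu; last by apply: measurableX => //; exact: measurable_cylinder.
rewrite product_measure1E//; last exact: measurable_cylinder.
by rewrite [X in (_ * X)%E]unit_lebesgue_setT mule1.
Qed.

(* The cylinders of two subgroups of index [k] differ by at least a cylinder
   of their intersection, so separability of [mu] leaves room for only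
   countably many subgroups of each index. *)
Lemma fin_normal_countable : countable [set: fin_normal G].
Proof.
(* Two subgroups of index [k] approximated by the same expression then have cylinders less than
   [1 / (k * k)] apart. *)
pose thr (k : nat) : R := (2 * (k * k)%:R)^-1.
have thr0 k : (0 < k)%N -> 0 < thr k.
  by move=> k0; rewrite invr_gt0 mulr_gt0// ltr0n muln_gt0 k0.
have /choice[b bP] : forall N : fin_normal G, exists b,
    (mu (pullback N 1%g `+` bset C b) < (thr (coset_index N))%:E)%E.
  move=> N; apply: appC; first exact: measurable_pullback.
  by apply: thr0; exact: coset_index_gt0.
pose code N := (coset_index N, choice.pickle (bexp_tree (b N))).
apply/countable_injP; exists (choice.pickle \o code) => N M _ _.
move=> /(pcan_inj choice.pickleK)[iNM /(pcan_inj choice.pickleK)/bexp_tree_inj bNM].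
have mb : measurable (bset C (b M)) by exact: measurable_bset.
have NM : (mu (pullback N 1%g `+` pullback M 1%g) < ((coset_index N * coset_index M)%:R^-1)%:E)%E.
  apply: le_lt_trans (measureY_triangle mu (measurable_pullback N 1%g) mb
    (measurable_pullback M 1%g)) _.
  have -> : (coset_index N * coset_index M)%:R^-1 = thr (coset_index N) + thr (coset_index M) :> R.
    have k0 : (coset_index M)%:R != 0 :> R by rewrite pnatr_eq0 -lt0n coset_index_gt0.
    by rewrite -iNM /thr natrM iNM; field.
  by rewrite EFinD lteD//; [rewrite -bNM|rewrite setYC]; exact: bP.
clear code bP iNM bNM mb thr thr0 b.
(* For [g] in [L] but not in [K], the cylinder of [g] for the intersection lies in that of [L] at 1
   and misses that of [K] at 1. Its measure is at least the inverse of the product of the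
   indices. *)
have sub (L K : fin_normal G) :
    (mu (pullback L 1%g `+` pullback K 1%g) < ((coset_index L * coset_index K)%:R^-1)%:E)%E ->
    (L : set G) `<=` K.
  move=> LK g Lg; apply: contrapT => Kg; move: LK; apply/negP; rewrite -leNgt.
  have IJ := coset_index_fin_normalI L K.
  have := haar_cylinder_ge eta_haar (fin_normalI L K) g.
  set I := fin_normalI L K in IJ *.
  have I0 : (0 < coset_index I)%N by exact: coset_index_gt0.
  move=> h.
  have cE : (eta (cylinder I g) \is a fin_num).
    by apply: fin_num_measure; exact: measurable_cylinder.
  apply: (@le_trans _ _ (eta (cylinder I g))).
    move: h; rewrite -(fineK cE) -EFinM !lee_fin => h.
    rewrite -[leLHS]mulr1 ler_pdivrMl ?ltr0n; last by rewrite (leq_trans I0).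
    apply: le_trans h _; rewrite ler_wpM2r ?ler_nat//.
    exact: fine_ge0.
  rewrite -mu_pullback le_measure ?inE//.
  - exact: measurable_pullback.
  - by apply: measurableY; exact: measurable_pullback.
  move=> x [xI _]; left; split.
    split=> //; have IL : (I : set G) `<=` L by move=> t [].
    have := cylinder_sub IL xI.
    have /lcoset_of_eqP : (L : set G) (1%g^-1 * g)%g by rewrite invg1 mul1g.
    by rewrite /cylinder /= => ->.
  have IK : (I : set G) `<=` K by move=> t [].
  move=> [/= x1 _]; have : (f x).1 K = lcoset_of K g by exact: (cylinder_sub IK xI).
  by rewrite x1 => /lcoset_of_eqP; rewrite invg1 mul1g.
apply: fin_normal_ext; apply/seteqP; split; apply: sub => //.
by rewrite setYC mulnC.
Qed.

End ProfiniteFactor.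

Lemma countable_enumeration (T : Type) (t0 : T) : countable [set: T] ->
  exists e : nat -> T, forall t, exists i, e i = t.
Proof.
move=> /countable_injP[code codeinj].
have /choice[e eP] : forall n, exists t, forall u, code u = n -> t = u.
  move=> n; have [[t tn]|nt] := pselect (exists t, code t = n).
    by exists t => u un; apply: codeinj; rewrite ?inE// tn.
  by exists t0 => u un; case: nt; exists u.
by exists e => t; exists (code t); exact: eP.
Qed.

Section ProfiniteGenerators.
Context (G : groupType) (R : realType).
Variables (eN : nat -> fin_normal G) (eG : nat -> G).
Hypothesis eN_surj : forall N, exists i, eN i = N.
Hypothesis eG_surj : forall g, exists i, eG i = g.

Definition prof_generator (i : nat * nat + nat) : set (prof_borel G * measurableTypeR R) :=
  match i with
  | inl p => cylinder (eN p.1) (eG p.2) `*` setT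
  | inr n => setT `*` @rational_ray R n
  end.

Definition basic_open (l : seq (nat * nat)) : set (profinite G) :=
  [set x | forall p, p \in l -> cylinder (eN p.1) (eG p.2) x].

(** Every subbasic set containing [x] is the cylinder of the coset [x N], so finitely many coded
    cylinders describe a neighbourhood. *)
Lemma open_basic_open (O : set (profinite G)) x : open O -> O x ->
  exists l, basic_open l x /\ basic_open l `<=` O.
Proof.
move=> [B BI <-] [W BW Wx]; have [D Dsub WE] := BI _ BW.
have /choice[q qP] : forall U : set (profinite G), exists p, U \in D ->
    cylinder (eN p.1) (eG p.2) = U.
  move=> U; have [UD|nU] := pselect (U \in D); last by exists (0, 0)%N.
  have : U x by have := Wx; rewrite -WE => /(_ _ UD).
  have /set_mem[N [K ->]] := Dsub U UD; rewrite /= => xN.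
  have [h xh] := prof_coset x N.
  have [i iN] := eN_surj N; have [j jh] := eG_surj h.
  by exists (i, j); rewrite iN jh /cylinder /= -xh xN.
have lW : basic_open (map q D) = W.
  rewrite -WE; apply/seteqP; split => y.
    by move=> yq U /= UD; rewrite -(qP U UD); apply: yq; exact: map_f.
  by move=> yD _ /mapP[U UD ->]; rewrite qP//; exact: yD.
exists (map q D); split; first by rewrite lW.
by rewrite lW => y Wy; exists W.
Qed.

(** Subgroups and cosets being enumerated, the topology has a countable base, so every open set is a
    countable union of finite intersections of cylinders. *)
Lemma prof_generatorP (B : set (prof_borel G * measurableTypeR R)) :
  measurable B -> <<s range prof_generator >> B.
Proof.
pose S := g_sigma_algebraType (range prof_generator).
have genS i : measurable (prof_generator i : set S).
  by apply: sub_sigma_algebra; exists i.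
apply: smallest_sub; first exact: smallest_sigma_algebra.
move=> _ [[A mA <-]|[A mA <-]]; rewrite setTI.
  apply: (@generated_preimage _ _ (<<s range prof_generator >>) fst
    (@open (profinite G)) _ _ A mA); first exact: smallest_sigma_algebra.
  move=> O oO; change (measurable (fst @^-1` O : set S)).
  have mbasic l : measurable (fst @^-1` basic_open l : set S).
    elim: l => [|p l IH].
      by rewrite (_ : _ @^-1` _ = setT)//; apply/seteqP; split.
    rewrite (_ : _ @^-1` _ = prof_generator (inl p) `&` fst @^-1` basic_open l).
      by apply: measurableI => //; exact: genS.
    apply/seteqP; split => [z zl|z [[zp _] zl] r].
      split; last by move=> r rl; apply: zl; rewrite inE rl orbT.
      by split => //; apply: zl; exact: mem_head.
    by rewrite inE => /orP[/eqP ->//|]; exact: zl.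
  pose K n : set S := if @choice.unpickle (seq (nat * nat)) n is Some l then
      (if `[< basic_open l `<=` O >] then fst @^-1` basic_open l else set0) else set0.
  have -> : fst @^-1` O = \bigcup_n K n.
    apply/seteqP; split => z.
      move=> Oz; have [l [lz lO]] := open_basic_open oO Oz.
      by exists (choice.pickle l) => //; rewrite /K choice.pickleK asboolT.
    move=> [n _]; rewrite /K; case: choice.unpickle => // l.
    by case: asboolP => // lO; exact: lO.
  apply: bigcup_measurable => n _; rewrite /K; case: choice.unpickle => // l.
  by case: ifP.
apply: (@generated_preimage _ _ (<<s range prof_generator >>) snd
  (range (@rational_ray R)) _ _ A (rational_ray_generates mA)).
  exact: smallest_sigma_algebra.
move=> _ [n _ <-]; apply: sub_sigma_algebra; exists (inr n) => //.
by rewrite /prof_generator setTX.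
Qed.

End ProfiniteGenerators.

Section ProfiniteRecurrence.
Context (G : groupType) d (X : measurableType d) (R : realType)
  (mu : probability X R).
Hypothesis G_infinite : infinite_set [set: G].
Hypothesis G_countable : countable [set: G].

Lemma fin_normalT : fin_normal G.
Proof.
exists setT; [by split => [|g h _ _]; apply: mem_set|by []|].
rewrite /finite_index; have -> : range (lcoset_of [set: G]) = [set setT].
  apply/seteqP; split => [_ [g _ <-]|_ ->]; last first.
    by exists 1%g => //; apply/seteqP; split => // h _; exists h => //; rewrite mul1g.
  by apply/seteqP; split => // h _; exists (g^-1 * h)%g => //; rewrite mulVKg.
exact: finite_set1.
Qed.

Lemma profinite_conjugate_recurrence (C : nat -> set X) (a : actions G mu)
    (eta : probability (prof_borel G) R) :
  (forall i, measurable (C i)) ->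
  (forall A, measurable A -> approximable mu C A) ->
  is_haar eta ->
  measure_conjugate a (eta \x unit_lebesgue R)%E (@prof_act G R) ->
  recurrence_set C a.
Proof.
move=> mC appC haar [f fiso fa].
have [mf f_mu _] := fiso.
have Nc := fin_normal_countable haar mf f_mu mC appC.
have [eN eNs] := countable_enumeration fin_normalT Nc.
have [eG eGs] := countable_enumeration 1%g G_countable.
have mgen i : measurable (@prof_generator G R eN eG i).
  case: i => [p|n] /=; apply: measurableX => //; first exact: measurable_cylinder.
  exact: measurable_itv.
have [mfgen appgen] := approximable_iso (inr 0%N) fiso mgen (prof_generatorP eNs eGs).
(* Along this filter [w] eventually lies in each finite-index normal subgroup. It then fixes the
   cylinders of that subgroup exactly, while the half-lines in the second coordinate are fixed by
   every [w]. *)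
pose F : set_system G := [set S | exists s : seq nat, forall w,
  (forall i, i \in s -> (eN i : set G) w) -> S w].
have FF : Filter F.
  split; first by exists [::].
    move=> P Q [s sP] [t tQ]; exists (s ++ t) => w wst.
    split; [apply: sP|apply: tQ] => i ist; apply: wst; rewrite mem_cat ist ?orbT//.
  by move=> P Q PQ [s sP]; exists s => w ws; apply: PQ; exact: sP.
have nf A : measurable A -> nearly_fixed mu F (act a) A.
  apply: (@nearly_fixed_approximable _ _ _ _ _ _ _ _
      (fun i => f @^-1` @prof_generator G R eN eG i)) => //.
  - exact: act_measurable.
  - by move=> w B mB; exact: act_mp.
  move=> i e e0.
  exists (if i is inl p then [:: p.1] else [::]) => w wi.
  rewrite measureY_ae0//; [exact: act_preimage_measurable|].
  apply: filterS (fa w) => x fx.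
  have key (N : fin_normal G) : (N : set G) w -> prof_mul (prof_inj w) (f x).1 N = (f x).1 N.
    move=> Nw; have [h xh] := prof_coset (f x).1 N.
    by rewrite (prof_mul_injE w xh) lcoset_of_abs.
  rewrite /preimage /mkset fx; case: i wi => [p|n] wp; last by [].
  have /key kp : (eN p.1 : set G) w by apply: wp; rewrite inE.
  by split=> -[h _]; split => //; [exact: etrans (esym kp) h|exact: etrans kp h].
apply: recurrence_setP => // n.
have n0 : (0 < n.+1%:R^-1 :> R) by rewrite invr_gt0.
have [s sP] : \forall w \near F, forall i, i \in iota 0 n ->
    (mu (act a w @^-1` C i `+` C i) < (n.+1%:R^-1)%:E)%E.
  by apply: near_seq => i _; exact: nf.
(* Finitely many cosets occur, so infinitely many group elements share all of them; their quotients
   lie in every [eN i] with [i] in [s]. *)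
have sfin : finite_set (range (fun g => [seq lcoset_of (eN i) g | i <- s])).
  elim: {sP} s => [|i s IH] /=.
    by apply: sub_finite_set (finite_set1 [::]) => _ [g _ <-].
  by apply: (finite_image11 (fun A l => A :: l)) => //; exact: fin_normal_index.
have [g0 [W [nW WP]]] := infinite_repetition n G_infinite sfin.
exists W => // w i wW ni; apply: sP; last by rewrite mem_iota.
move=> j js; have /eq_in_map/(_ j js)/esym/lcoset_of_eqP := WP w wW.
by rewrite mulKg.
Qed.

End ProfiniteRecurrence.

(** * Product groups *)

Section Affine.
Variable R : realType.
Local Notation TR := (measurableTypeR R).

Lemma measurable_affine (k b : R) : measurable_fun setT (fun x : TR => (k * x + b : TR)).
Proof. by apply: measurable_funD => //; exact: measurable_funM. Qed.

(** By uniqueness of Lebesgue measure, it is enough to compare both sides on half-open intervals. *)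
Lemma lebesgue_measure_affine (k b : R) (A : set TR) : 0 < k -> measurable A ->
  lebesgue_measure A = (k%:E * lebesgue_measure ((fun x : TR => (k * x + b)%R) @^-1` A))%E.
Proof.
move=> k0 mA; have k0' : 0 <= k := ltW k0.
have mf := measurable_affine k b.
pose f (x : TR) : TR := k * x + b.
have [m mE] : exists m : {measure set TR -> \bar R},
    forall B, m B = lebesgue_measure (f @^-1` B).
  by unshelve eexists (pushforward lebesgue_measure f : {measure set TR -> \bar R}).
rewrite -[X in (_ * X)%E]mE; transitivity (mscale (NngNum k0') m A); last by [].
apply: lebesgue_measure_unique => // _ [[a c] _ <-].
rewrite /mscale /= [X in (_ = _ * X)%E](mE `]a, c]%classic).
have -> : f @^-1` `]a, c]%classic = `](a - b) / k, (c - b) / k]%classic.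
  apply/seteqP; split => x /=; rewrite !in_itv /= ltr_pdivrMr// ler_pdivlMr//;
  by rewrite ltrBlDr lerBrDr mulrC.
rewrite !lebesgue_measure_itv /= !lte_fin ltr_pM2r ?invr_gt0// ltrD2r.
case: ifP => _; last by rewrite mule0.
rewrite -EFinB -EFinB -EFinM; congr EFin.
by rewrite -mulrBl mulrC divfK ?gt_eqF//; ring.
Qed.

End Affine.

(** * Splitting the unit interval into X x Y *)

Section Cells.
Variable R : realType.
Local Notation TR := (measurableTypeR R).

Definition intpart (x : R) : R := (Num.floor x)%:~R.
Definition fracpart (x : R) : R := x - intpart x.

Lemma fracpart_itv x : 0 <= fracpart x < 1.
Proof.
have := floor_itv x; rewrite /fracpart /intpart intrD => /andP[h1 h2].
by rewrite subr_ge0 h1 ltrBlDl.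
Qed.

Lemma intpart_addint (z : int) (t : R) : 0 <= t < 1 -> intpart (z%:~R + t) = z%:~R.
Proof.
move=> /andP[t0 t1]; rewrite /intpart (@floor_def _ _ z)//.
by rewrite lerDl t0 intrD ltrD2l.
Qed.

Lemma fracpart_addint (z : int) (t : R) : 0 <= t < 1 -> fracpart (z%:~R + t) = t.
Proof. by move=> t01; rewrite /fracpart intpart_addint// addrC addKr. Qed.

Lemma measurable_intpart : measurable_fun setT (intpart : TR -> TR).
Proof.
by apply: nondecreasing_measurable => // x y xy; rewrite /intpart ler_int le_floor.
Qed.

Lemma measurable_fracpart : measurable_fun setT (fracpart : TR -> TR).
Proof. by apply: measurable_funB => //; exact: measurable_intpart. Qed.

Variables (M k : nat).
Hypothesis M0 : (0 < M)%N.
Hypothesis k0 : (0 < k)%N.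
Let m : R := M%:R.
Let K : R := k%:R.
Let m0 : 0 < m. Proof. by rewrite ltr0n. Qed.
Let K0 : 0 < K. Proof. by rewrite ltr0n. Qed.

(* Each of the [M] cells of length [1 / M] is cut into [k] pieces; the [j]-th
   piece is stretched affinely onto the whole cell by [stretch], and
   [squeeze j] is the inverse map. *)
Definition piece (x : R) : nat := Num.truncn (K * fracpart (m * x)).
Definition stretch (x : TR) : TR := (intpart (m * x) + fracpart (K * fracpart (m * x))) / m.
Definition squeeze (j : nat) (x : TR) : TR :=
  (intpart (m * x) + (j%:R + fracpart (m * x)) / K) / m.

Lemma Kfrac_ge0 x : 0 <= K * fracpart (m * x).
Proof. by have /andP[f0 _] := fracpart_itv (m * x); rewrite mulr_ge0. Qed.

Lemma piece_eq j x : piece x = j <-> j%:R <= K * fracpart (m * x) < j.+1%:R.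
Proof.
by rewrite -truncn_eq ?Kfrac_ge0//; split => [<-|/eqP].
Qed.

Lemma piece_lt x : (piece x < k)%N.
Proof.
have /andP[f0 f1] := fracpart_itv (m * x).
by rewrite truncn_lt_nat ?Kfrac_ge0// -[ltRHS]mulr1 ltr_pM2l.
Qed.

Lemma measurable_stretch : measurable_fun setT stretch.
Proof.
have mm : measurable_fun setT (fun x : TR => m * x : TR) by exact: measurable_funM.
apply: measurable_funM => //; apply: measurable_funD.
  exact: (measurableT_comp measurable_intpart mm).
apply: (measurableT_comp measurable_fracpart); apply: measurable_funM => //.
exact: (measurableT_comp measurable_fracpart mm).
Qed.

Lemma measurable_squeeze j : measurable_fun setT (squeeze j).
Proof.
have mm : measurable_fun setT (fun x : TR => m * x : TR) by exact: measurable_funM.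
apply: measurable_funM => //; apply: measurable_funD.
  exact: (measurableT_comp measurable_intpart mm).
apply: measurable_funM => //; apply: measurable_funD => //.
exact: (measurableT_comp measurable_fracpart mm).
Qed.

Lemma measurable_piece j : measurable (piece @^-1` [set j] : set TR).
Proof.
have mh : measurable_fun setT (fun x : TR => K * fracpart (m * x) : TR).
  apply: measurable_funM => //; apply: (measurableT_comp measurable_fracpart).
  exact: measurable_funM.
have -> : piece @^-1` [set j] =
    (fun x : TR => K * fracpart (m * x) : TR) @^-1` `[j%:R, j.+1%:R[%classic.
  by apply/seteqP; split => x /=; rewrite in_itv /= => /piece_eq.
by rewrite -[_ @^-1` _]setTI; apply: mh => //; exact: measurable_itv.
Qed.

Lemma squeeze_frac j x : (j < k)%N -> 0 <= (j%:R + fracpart (m * x)) / K < 1.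
Proof.
move=> jk; have /andP[f0 f1] := fracpart_itv (m * x).
apply/andP; split; first by rewrite divr_ge0 ?(ltW K0)// addr_ge0.
rewrite ltr_pdivrMr// mul1r.
have : (j.+1%:R : R) <= K by rewrite ler_nat.
by rewrite -natr1; lra.
Qed.

Lemma mul_squeeze j x : m * squeeze j x =
  intpart (m * x) + (j%:R + fracpart (m * x)) / K.
Proof. by rewrite /squeeze mulrC divfK ?gt_eqF. Qed.

Lemma fracpart_squeeze j x : (j < k)%N ->
  K * fracpart (m * squeeze j x) = j%:R + fracpart (m * x).
Proof.
move=> jk; rewrite mul_squeeze /fracpart intpart_addint ?squeeze_frac//.
by rewrite addrC addKr mulrC divfK ?gt_eqF.
Qed.

Lemma squeezeK j x : (j < k)%N -> stretch (squeeze j x) = x.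
Proof.
move=> jk; rewrite /stretch fracpart_squeeze// mul_squeeze.
rewrite [intpart (_ + _)]intpart_addint ?squeeze_frac//.
rewrite /fracpart -[j%:R]/((Posz j)%:~R) intpart_addint ?fracpart_itv//.
rewrite [_ + fracpart _]addrC addrK /fracpart addrC subrK mulrC.
by rewrite mulKf ?gt_eqF.
Qed.

Lemma piece_squeeze j x : (j < k)%N -> piece (squeeze j x) = j.
Proof.
move=> jk; apply/piece_eq; rewrite fracpart_squeeze// -natr1 ltrD2l lerDl.
exact: fracpart_itv.
Qed.

Lemma mul_stretch x : m * stretch x = intpart (m * x) + fracpart (K * fracpart (m * x)).
Proof. by rewrite /stretch mulrC divfK ?gt_eqF. Qed.

Lemma intpart_piece x : intpart (K * fracpart (m * x)) = (piece x)%:R.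
Proof.
have /piece_eq /andP[h1 h2] := erefl (piece x).
rewrite /intpart (@floor_def _ _ (Posz (piece x)))//.
by rewrite h1 /= intrD natr1.
Qed.

Lemma stretchK x : squeeze (piece x) (stretch x) = x.
Proof.
have f01 := fracpart_itv (K * fracpart (m * x)).
rewrite /squeeze mul_stretch [fracpart (_ + _)](fracpart_addint _ f01).
rewrite [intpart (_ + _)](intpart_addint _ f01) -/(intpart _) -intpart_piece.
rewrite -/(intpart _) {2}/fracpart addrC subrKC [K * _]mulrC mulfK ?gt_eqF//.
by rewrite [fracpart _ + _]addrC /fracpart subrKC mulrC mulKf ?gt_eqF.
Qed.

Definition cell (c : nat) : set TR := `[c%:R / m, c.+1%:R / m[%classic.

Lemma cellP c x : cell c x <-> c%:R <= m * x < c.+1%:R.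
Proof. by rewrite /cell /= in_itv /= ler_pdivrMr// ltr_pdivlMr// mulrC. Qed.

Lemma measurable_cell c : measurable (cell c).
Proof. exact: measurable_itv. Qed.

(** The [M] cells tile the half-open interval; the endpoint 1 is a null set. *)
Lemma unit_lebesgue_cells (E : set TR) : measurable E ->
  unit_lebesgue R E = (\sum_(c < M) lebesgue_measure (E `&` cell c))%E.
Proof.
move=> mE; pose F c := E `&` cell c.
have mF c : measurable (F c) by apply: measurableI => //; exact: measurable_cell.
have tF : trivIset setT F.
  move=> c c' _ _ [x [[_ /cellP/andP[h1 h2]] [_ /cellP/andP[h3 h4]]]].
  apply/eqP; rewrite eqn_leq; apply/andP; split; rewrite -ltnS -(ltr_nat R).
    exact: le_lt_trans h1 h4.
  exact: le_lt_trans h3 h2.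
rewrite -(measure_bigsetU lebesgue_measure mF tF).
have UF : \big[setU/set0]_(c < M) F c = E `&` `[0, 1[%classic.
  rewrite -bigcup_mkord; apply/seteqP; split => [x [c /= cM [Ex /cellP/andP[h1 h2]]]|x [Ex]].
    split => //; rewrite /= in_itv /=; apply/andP; split.
      by rewrite -(pmulr_rge0 _ m0) (le_trans _ h1).
    rewrite -(ltr_pM2l m0) mulr1; apply: lt_le_trans h2 _.
    by rewrite ler_nat.
  rewrite /= in_itv /= => /andP[x0 x1]; have mx0 : 0 <= m * x by rewrite mulr_ge0// ltW.
  exists (Num.truncn (m * x)) => /=.
    by rewrite truncn_lt_nat// -[ltRHS]mulr1 ltr_pM2l.
  by split => //; apply/cellP; exact: truncn_itv.
have m1 : measurable (E `&` [set 1] : set TR) by apply: measurableI.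
have mE0 : measurable (E `&` `[0, 1[%classic : set TR).
  by apply: measurableI => //; exact: measurable_itv.
rewrite UF /unit_lebesgue /mrestr.
have -> : E `&` `[0, 1]%classic = (E `&` `[0, 1[%classic) `|` (E `&` [set 1]).
  rewrite -setIUr; congr (_ `&` _); apply/seteqP; split => x /=; rewrite !in_itv /=.
    by move=> /andP[-> /=]; rewrite le_eqVlt => /orP[/eqP|]; [right|left].
  by move=> [/andP[-> /ltW]//|->]; rewrite ler01 lexx.
rewrite measureU//.
  rewrite [X in (_ + X)%E](_ : _ = 0%E) ?adde0//; apply/eqP.
  rewrite eq_le measure_ge0 andbT -(lebesgue_measure_set1 (1 : R)).
  by apply: le_measure; rewrite ?inE//; exact: subIsetr.
apply/seteqP; split => // x [[_ +] [_ x1]]; rewrite x1 /= in_itv /=.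
by rewrite ltxx andbF.
Qed.

Lemma unit_lebesgue_split j (B : set TR) : (j < k)%N -> measurable B ->
  unit_lebesgue R (piece @^-1` [set j] `&` stretch @^-1` B) =
    ((K^-1)%:E * unit_lebesgue R B)%E.
Proof.
move=> jk mB.
have mS : measurable (stretch @^-1` B).
  by rewrite -[_ @^-1` _]setTI; exact: measurable_stretch.
have mP := measurable_piece j.
rewrite unit_lebesgue_cells; last exact: measurableI.
rewrite unit_lebesgue_cells// ge0_sume_distrr//.
apply: eq_bigr => c _.
(* With this offset [K * x + b] sends the left end [(c + j / K) / m] of the piece to the left end
   [c / m] of its cell. *)
pose b : R := - ((j%:R + (K - 1) * c%:R) / m).
have mBc : measurable (B `&` cell c) by apply: measurableI => //; exact: measurable_cell.
rewrite (lebesgue_measure_affine b K0 mBc) muleA -EFinM mulVf ?gt_eqF// mul1e.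
congr lebesgue_measure.
have mphi x : m * (K * x + b) = K * (m * x - c%:R) - j%:R + c%:R.
  rewrite /b mulrDr mulrN [m * (_ / m)]mulrC divfK ?gt_eqF//; ring.
have intc x : cell c x -> intpart (m * x) = c%:R.
  move=> /cellP /andP[h1 h2]; rewrite /intpart (@floor_def _ _ (Posz c))//.
  by rewrite h1 /= intrD natr1.
have str x : cell c x -> piece x = j -> stretch x = K * x + b.
  move=> xc xj; have -> : stretch x =
      (intpart (m * x) + (K * fracpart (m * x) - intpart (K * fracpart (m * x)))) / m by [].
  by rewrite intpart_piece xj /fracpart intc// /b; field; rewrite gt_eqF.
apply/seteqP; split => x /=.
  move=> [[/= xj Bx] xc]; rewrite -(str x xc xj); split => //.
  apply/cellP; rewrite str// mphi.
  have /piece_eq := xj; rewrite /fracpart intc// -!natr1 => /andP[h1 h2].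
  by apply/andP; split; lra.
move=> [Bx /cellP]; rewrite mphi -!natr1 => /andP[h1 h2].
have jk1 : j%:R + 1 <= K by rewrite natr1 ler_nat.
have u0 : 0 <= m * x - c%:R.
  by rewrite -(pmulr_rge0 _ K0); have : 0 <= j%:R :> R by []; lra.
have u1 : m * x - c%:R < 1 by rewrite -(ltr_pM2l K0); lra.
have xc : cell c x by apply/cellP; rewrite -natr1; apply/andP; split; lra.
have xj : piece x = j.
  by apply/piece_eq; rewrite /fracpart intc// -natr1; apply/andP; split; lra.
by split => //; split => //=; rewrite str.
Qed.

Lemma stretch_near x : `|stretch x - x| <= m^-1.
Proof.
have /andP[f0 f1] := fracpart_itv (m * x).
have /andP[g0 g1] := fracpart_itv (K * fracpart (m * x)).
have xE : m * x = intpart (m * x) + fracpart (m * x) by rewrite /fracpart addrC subrK.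
rewrite -(ler_pM2l m0) mulfV ?gt_eqF// -{1}(gtr0_norm m0) -normrM mulrBr mul_stretch.
by rewrite ler_norml; apply/andP; split; lra.
Qed.

(** [stretch] moves points by at most [1 / m], so only points within [1 / m] of [q] can change
    sides. *)
Lemma unit_lebesgue_stretch_ray (q : R) :
  (unit_lebesgue R (stretch @^-1` `]q, +oo[%classic `+` `]q, +oo[%classic) <=
    (2 / m)%:E)%E.
Proof.
have mray : measurable (`]q, +oo[%classic : set TR) by exact: measurable_itv.
have mS : measurable (stretch @^-1` `]q, +oo[%classic).
  by rewrite -[_ @^-1` _]setTI; exact: measurable_stretch.
have mI : measurable (`[q - m^-1, q + m^-1]%classic : set TR) by exact: measurable_itv.
apply: (@le_trans _ _ (lebesgue_measure (`[q - m^-1, q + m^-1]%classic : set TR))).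
  rewrite /unit_lebesgue /mrestr; apply: le_measure; rewrite ?inE//.
    by apply: measurableI; [apply: measurableU; apply: measurableD|exact: measurable_itv].
  move=> x [+ _]; have := stretch_near x; rewrite ler_norml /setY /= !in_itv /= !andbT.
  move=> /andP[h1 h2] [[h3 /negP]|[h3 /negP]]; rewrite -leNgt => h4;
  by apply/andP; split; lra.
rewrite lebesgue_measure_itv /= lte_fin; case: ifP => _; last by rewrite lee_fin divr_ge0.
by rewrite -EFinD lee_fin; lra.
Qed.

End Cells.

Section Splitting.
Context d (X : measurableType d) (R : realType) (mu : probability X R).

(* [x |-> (A x, kappa x)] is an isomorphism of [X] with [X * Y], up to null
   sets, for the uniform probability on [Y]; its inverse is [(x, y) |-> sigma y x]. *)
Record splitting (Y : finType) (A : X -> X) (kappa : X -> Y) (sigma : Y -> X -> X) : Prop :=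
  Splitting {
    split_mA : measurable_fun setT A ;
    split_mkappa : forall y, measurable (kappa @^-1` [set y]) ;
    split_msigma : forall y, measurable_fun setT (sigma y) ;
    split_AK : forall y, \forall x \ae mu, A (sigma y x) = x ;
    split_kappaK : forall y, \forall x \ae mu, kappa (sigma y x) = y ;
    split_sigmaK : \forall x \ae mu, sigma (kappa x) (A x) = x ;
    split_mu : forall y B, measurable B ->
      mu (kappa @^-1` [set y] `&` A @^-1` B) = ((#|Y|%:R^-1)%:E * mu B)%E }.

(** [stretch], [piece] and [squeeze] are transported to [X] along [f] and its inverse [g]. As
    [f (g y) = y] fails on a null set [N], the preimages of [N] under these maps must be shown to be
    null. *)
Lemma lebesgue_splitting (f : X -> measurableTypeR R) (Y : finType) (y0 : Y) (n : nat) :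
  measure_iso mu (unit_lebesgue R) f ->
  exists A kappa sigma, @splitting Y A kappa sigma /\
    forall q : R, (mu (A @^-1` (f @^-1` `]q, +oo[) `+` f @^-1` `]q, +oo[) <=
      (2 / n.+1%:R)%:E)%E.
Proof.
move=> [mf f_mu [g [mg gf fg]]].
pose k := #|Y|; have k0 : (0 < k)%N by apply/card_gt0P; exists y0.
have n0 : (0 < n.+1)%N by [].
pose A0 := @stretch R n.+1 k; pose p0 := @piece R n.+1 k; pose s0 := @squeeze R n.+1 k.
have mA0 : measurable_fun setT A0 by exact: measurable_stretch.
have ms0 j : measurable_fun setT (s0 j) by exact: measurable_squeeze.
have mpre (h : measurableTypeR R -> measurableTypeR R) B :
    measurable_fun setT h -> measurable B -> measurable (h @^-1` B).
  by move=> mh mB; rewrite -[_ @^-1` _]setTI; exact: mh.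
have mgpre B : measurable B -> measurable (g @^-1` B).
  by move=> mB; rewrite -[_ @^-1` _]setTI; exact: mg.
have mfpre B : measurable B -> measurable (f @^-1` B).
  by move=> mB; rewrite -[_ @^-1` _]setTI; exact: mf.
have g_mu B : measurable B -> unit_lebesgue R (g @^-1` B) = mu B.
  move=> mB; rewrite f_mu; last exact: mgpre.
  apply: ae_measure_eq => //; first by apply: mfpre; exact: mgpre.
  by apply: filterS gf => x /= ->.
pose rk (y : Y) : nat := enum_rank y.
have rk_lt y : (rk y < k)%N by rewrite /rk /k ltn_ord.
pose kappa x := enum_val (Ordinal (@piece_lt R n.+1 k k0 (f x))).
have kappaP x y : kappa x = y <-> p0 (f x) = rk y.
  rewrite /kappa /rk; split => [<-|xy]; first by rewrite enum_valK.
  by apply: (can_inj enum_rankK); rewrite enum_valK; apply: val_inj.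
pose A x := g (A0 (f x)); pose sigma y x := g (s0 (rk y) (f x)).
have split0 y B : measurable B ->
    unit_lebesgue R (p0 @^-1` [set rk y] `&` A0 @^-1` B) =
    ((k%:R^-1)%:E * unit_lebesgue R B)%E.
  move=> mB; exact: unit_lebesgue_split.
have mp0 y : measurable (p0 @^-1` [set rk y] : set (measurableTypeR R)).
  exact: measurable_piece.
have [N [mN N0 NP]] := fg.
have fgN y : ~ N y -> f (g y) = y by move=> nN; apply: contrapT => h; apply: nN; exact: NP.
have negl_f (h : measurableTypeR R -> measurableTypeR R) : measurable_fun setT h ->
    unit_lebesgue R (h @^-1` N) = 0%E -> \forall x \ae mu, f (g (h (f x))) = h (f x).
  move=> mh hN; exists (f @^-1` (h @^-1` N)); split.
  - by apply: mfpre; exact: mpre.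
  - by rewrite -f_mu//; exact: mpre.
  - by move=> x /= hx; apply: contrapT => nN; apply: hx; exact: fgN.
have N0' : unit_lebesgue R N = 0%E by [].
have A0N : unit_lebesgue R (A0 @^-1` N) = 0%E.
  have mp : mlabel (p0 : measurableTypeR R -> nat) by move=> j; exact: measurable_piece.
  rewrite (@measure_label _ _ _ (unit_lebesgue R) _ _ _ mp (mpre _ _ mA0 mN)).
  apply: esum1 => j _; have [jk|kj] := ltnP j k.
    rewrite setIC; apply: etrans (unit_lebesgue_split n0 k0 jk mN) _.
    by rewrite N0' mule0.
  rewrite (_ : _ `&` _ = set0) ?measure0//; apply/seteqP; split => // x [_ /= xj].
  by have := @piece_lt R n.+1 k k0 x; rewrite -/p0 xj ltnNge kj.
have s0K y x : p0 x = rk y -> s0 (rk y) (A0 x) = x.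
  by move=> <-; exact: stretchK.
(* By [split0] this measure is [k] times that of the part of a piece that [A0] sends into the set;
   as [s0] inverts [A0] there, that part lies in [N]. *)
have s0N y : unit_lebesgue R (s0 (rk y) @^-1` N) = 0%E.
  have msN := mpre _ _ (ms0 (rk y)) mN.
  have := split0 y _ msN.
  have -> : unit_lebesgue R (p0 @^-1` [set rk y] `&` A0 @^-1` (s0 (rk y) @^-1` N)) = 0%E.
    apply/eqP; rewrite eq_le measure_ge0 andbT -N0'; apply: le_measure; rewrite ?inE//.
      by apply: measurableI => //; exact: mpre.
    by move=> x [/= xy]; rewrite s0K.
  move/esym/eqP; rewrite mule_eq0 eqe invr_eq0 pnatr_eq0 => /orP[/eqP k0'|/eqP//].
  by have := k0; rewrite k0'.
have fA : \forall x \ae mu, f (A x) = A0 (f x) by exact: negl_f.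
have fs y : \forall x \ae mu, f (sigma y x) = s0 (rk y) (f x) by exact: negl_f.
exists A, kappa, sigma; split; first split.
- exact: measurableT_comp mg (measurableT_comp mA0 mf).
- move=> y; rewrite (_ : _ @^-1` _ = f @^-1` (p0 @^-1` [set rk y])); first exact: mfpre.
  by apply/seteqP; split => x /kappaP.
- by move=> y; exact: measurableT_comp mg (measurableT_comp (ms0 _) mf).
- move=> y; apply: (filterS2 _ _ (fs y) gf) => x sx gx.
  by rewrite /A sx /A0 /s0 squeezeK.
- move=> y; apply: filterS (fs y) => x sx; apply/kappaP.
  by rewrite sx /p0 /s0 piece_squeeze.
- apply: (filterS2 _ _ fA gf) => x Ax gx.
  by rewrite /sigma Ax s0K//; exact/kappaP.
- move=> y B mB.
  have -> : kappa @^-1` [set y] `&` A @^-1` B =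
      f @^-1` (p0 @^-1` [set rk y] `&` A0 @^-1` (g @^-1` B)).
    by apply/seteqP; split => x [/kappaP h1 h2].
  rewrite -f_mu; last by apply: measurableI => //; apply: mpre => //; exact: mgpre.
  by apply: etrans (split0 y _ (mgpre _ mB)) _; rewrite g_mu.
move=> q; have mray : measurable (`]q, +oo[%classic : set (measurableTypeR R)).
  exact: measurable_itv.
apply: le_trans (unit_lebesgue_stretch_ray k n0 q).
have mA0r := mpre _ _ mA0 mray.
have mAr : measurable (A @^-1` (f @^-1` `]q, +oo[)).
  rewrite -[_ @^-1` _]setTI.
  by apply: (measurableT_comp mg (measurableT_comp mA0 mf)) => //; exact: mfpre.
rewrite f_mu; last by apply: measurableU; apply: measurableD.
rewrite le_eqVlt; apply/orP; left; apply/eqP; apply: ae_measure_eq.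
- by apply: measurableY => //; exact: mfpre.
- by apply: mfpre; apply: measurableU; apply: measurableD.
- by apply: filterS fA => x Ax; rewrite /setY /= Ax.
Qed.

End Splitting.

(** * Skew products over a finite set *)

Section Twist.
Context d (X : measurableType d) (R : realType) (mu : probability X R).
Variables (Y : finType) (A : X -> X) (kappa : X -> Y) (sigma : Y -> X -> X).
Hypothesis S : splitting mu A kappa sigma.

Let mkappa : mlabel kappa. Proof. exact: split_mkappa S. Qed.

Let mA B : measurable B -> measurable (A @^-1` B).
Proof. by move=> mB; rewrite -[_ @^-1` _]setTI; exact: (split_mA S). Qed.

Let msigma y B : measurable B -> measurable (sigma y @^-1` B).
Proof. by move=> mB; rewrite -[_ @^-1` _]setTI; exact: (split_msigma S). Qed.

Lemma ae_forall_fin (P : Y -> X -> Prop) : (forall y, \forall x \ae mu, P y x) ->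
  \forall x \ae mu, forall y, P y x.
Proof.
move=> Pae; have : \forall x \ae mu, forall y, y \in enum Y -> P y x.
  by apply: near_seq => y _; exact: Pae.
by apply: filterS => x Px y; apply: Px; rewrite mem_enum.
Qed.

Lemma split_A_ae (P : X -> Prop) :
  (\forall x \ae mu, P x) -> \forall x \ae mu, P (A x).
Proof.
move=> [N [mN N0 NP]]; exists (A @^-1` N); split.
- exact: mA.
- rewrite (measure_label mu mkappa (mA mN)); apply: esum1 => y _.
  by rewrite setIC (split_mu S)// N0 mule0.
- by move=> x /= nP; exact: NP.
Qed.

(** Fubini for the uniform measure on [Y]: [mu] is the average of its fibre measures. *)
Lemma split_sum B : measurable B ->
  mu B = \esum_(y in [set: Y]) ((#|Y|%:R^-1)%:E * mu (sigma y @^-1` B))%E.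
Proof.
move=> mB; rewrite (measure_label mu mkappa mB); apply: eq_esum => y _.
rewrite -(split_mu S y (msigma y mB)).
apply: ae_measure_eq.
- exact: measurableI.
- by apply: measurableI => //; apply: mA; exact: msigma.
apply: filterS (split_sigmaK S) => x Sx; split.
  by move=> [Bx /= xy]; split => //=; rewrite -xy Sx.
by move=> [/= xy]; rewrite -xy Sx.
Qed.

Lemma split_A_mp B : measurable B -> mu (A @^-1` B) = mu B.
Proof.
move=> mB; rewrite (split_sum (mA mB)).
have mu_sigmaA y : mu (sigma y @^-1` (A @^-1` B)) = mu B.
  apply: ae_measure_eq => //; first by apply: msigma; exact: mA.
  by apply: filterS (split_AK S y) => x /= ->.
have sum1 : \esum_(y in [set: Y]) (#|Y|%:R^-1)%:E = 1%:E :> \bar R.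
  rewrite -(@probability_setT _ _ _ mu) (split_sum measurableT); apply: eq_esum => y _.
  by rewrite preimage_setT probability_setT mule1.
rewrite -[RHS]mule1 -sum1 -(@fineK _ (mu B)) ?fin_num_measure//.
rewrite -esumZl//; last by rewrite fine_ge0.
by apply: eq_esum => y _; rewrite mu_sigmaA fineK ?fin_num_measure// muleC.
Qed.

(** In the coordinates [(A x, kappa x)] this is the skew product sending [(x, y)] to
    [(u y x, q y)]. *)
Definition twist (u : Y -> Aut mu) (q : Y -> Y) (x : X) : X :=
  sigma (q (kappa x)) (Aut_fun (u (kappa x)) (A x)).

Lemma twist_preimage (u : Y -> Aut mu) (q : Y -> Y) B :
  twist u q @^-1` B = \bigcup_(y in [set: Y]) (kappa @^-1` [set y] `&`
    A @^-1` (Aut_fun (u y) @^-1` (sigma (q y) @^-1` B))).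
Proof.
apply/seteqP; split => [x Bx|x [y _ [/= <- //]]].
by exists (kappa x).
Qed.

Lemma measurable_twist u q : measurable_fun setT (twist u q).
Proof.
move=> _ B mB; rewrite setTI twist_preimage; apply: fin_bigcup_measurable => //.
move=> y _; apply: measurableI => //; apply: mA; apply: Aut_fun_preimage_measurable.
exact: msigma.
Qed.

Lemma twist_mp u q B : injective q -> measurable B -> mu (twist u q @^-1` B) = mu B.
Proof.
move=> qinj mB; have mtB : measurable (twist u q @^-1` B).
  by rewrite -[_ @^-1` _]setTI; exact: measurable_twist.
rewrite (measure_label mu mkappa mtB) (split_sum mB).
rewrite (reindex_esum [set: Y] [set: Y] q); last first.
  split => //; first by move=> x y _ _; exact: qinj.
  by move=> y _; exists (invF qinj y) => //; rewrite f_invF.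
apply: eq_esum => y _.
have -> : twist u q @^-1` B `&` kappa @^-1` [set y] = kappa @^-1` [set y] `&`
    A @^-1` (Aut_fun (u y) @^-1` (sigma (q y) @^-1` B)).
  apply/seteqP; split => x [/= h1 h2]; split => //=; first by rewrite -h2.
  by rewrite /twist h1.
rewrite (split_mu S); last by apply: Aut_fun_preimage_measurable; exact: msigma.
by rewrite [mu (_ @^-1` _)]mp_fun_mp//; exact: msigma.
Qed.

Lemma split_A_twist u q :
  \forall x \ae mu, A (twist u q x) = Aut_fun (u (kappa x)) (A x).
Proof.
have h y : \forall x \ae mu,
    A (sigma (q y) (Aut_fun (u y) (A x))) = Aut_fun (u y) (A x).
  apply: (@split_A_ae (fun x => A (sigma (q y) (Aut_fun (u y) x)) = Aut_fun (u y) x)).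
  exact: (ae_mp_preimage (repr (u y)) (split_AK S (q y))).
by apply: filterS (ae_forall_fin h) => x; exact.
Qed.

Lemma split_kappa_twist u q : \forall x \ae mu, kappa (twist u q x) = q (kappa x).
Proof.
have h y : \forall x \ae mu, kappa (sigma (q y) (Aut_fun (u y) (A x))) = q y.
  apply: (@split_A_ae (fun x => kappa (sigma (q y) (Aut_fun (u y) x)) = q y)).
  exact: (ae_mp_preimage (repr (u y)) (split_kappaK S (q y))).
by apply: filterS (ae_forall_fin h) => x; exact.
Qed.

Lemma twist_mul u v q r : \forall x \ae mu,
  twist u q (twist v r x) = twist (fun y => Aut_mul (u (r y)) (v y)) (q \o r) x.
Proof.
have h : \forall x \ae mu, forall y,
    Aut_fun (Aut_mul (u (r y)) (v y)) (A x) = Aut_fun (u (r y)) (Aut_fun (v y) (A x)).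
  by apply: ae_forall_fin => y; exact: (split_A_ae (Aut_fun_mul (u (r y)) (v y))).
apply: (filterS3 _ _ (split_A_twist v r) (split_kappa_twist v r) h) => x k1 k2 k3.
by rewrite [LHS]/twist k1 k2 /twist /= k3.
Qed.

Lemma mu_kappa_le (s : seq Y) :
  (mu (kappa @^-1` [set y | y \in s]) <= ((size s)%:R * #|Y|%:R^-1)%:E)%E.
Proof.
elim: s => [|y s IH].
  rewrite (_ : _ @^-1` _ = set0); first by rewrite measure0 mul0r.
  by apply/seteqP; split.
have ms (t : seq Y) : measurable (kappa @^-1` [set y | y \in t]).
  exact: measurable_label_set.
have -> : kappa @^-1` [set z | z \in y :: s] =
    kappa @^-1` [set y] `|` kappa @^-1` [set z | z \in s].
  apply/seteqP; split => x /=; rewrite inE; first by move=> /orP[/eqP|]; [left|right].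
  by move=> [->|->]; rewrite ?eqxx ?orbT.
apply: le_trans (measureU2 _ (mkappa y) (ms s)) _.
rewrite -[size (y :: s)]/(size s).+1 -natr1 mulrDl mul1r EFinD addeC leeD//.
have E : mu (kappa @^-1` [set y]) = (#|Y|%:R^-1)%:E.
  rewrite -[kappa @^-1` [set y]]setIT -(preimage_setT A) (split_mu S)//.
  by rewrite probability_setT mule1.
by rewrite le_eqVlt; apply/orP; left; apply/eqP; exact: E.
Qed.

Lemma twist_one u q : (forall y, u y = Aut_one mu) -> (forall y, q y = y) ->
  \forall x \ae mu, twist u q x = x.
Proof.
move=> u1 q1; apply: (filterS2 _ _ (split_sigmaK S) (split_A_ae (Aut_fun_one mu))).
by move=> x Sx Ax; rewrite /twist u1 q1 Ax.
Qed.

(** The cocycle identity makes the twists multiplicative almost everywhere, so the twist of [g^-1]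
    inverts that of [g] and [Aut_of_ae_inverse] yields automorphisms. *)
Lemma cocycle_action (G : groupType) (q : G -> Y -> Y) (u : G -> Y -> Aut mu) :
  is_action q -> (forall y, u 1%g y = Aut_one mu) ->
  (forall g h y, u (g * h)%g y = Aut_mul (u g (q h y)) (u h y)) ->
  exists b : actions G mu, forall g, \forall x \ae mu, act b g x = twist (u g) (q g) x.
Proof.
move=> qA u1 uM; have tM g h : \forall x \ae mu,
    twist (u g) (q g) (twist (u h) (q h) x) = twist (u (g * h)%g) (q (g * h)%g) x.
  apply: filterS (twist_mul (u g) (u h) (q g) (q h)) => x ->.
  by rewrite /twist uM /= qA.2.
have t1 : \forall x \ae mu, twist (u 1%g) (q 1%g) x = x.
  by apply: twist_one => // y; exact: qA.1.
have qinj g : injective (q g) by exact: can_inj (is_actionVK qA g).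
have /choice[B BE] : forall g, exists U : Aut mu,
    \forall x \ae mu, Aut_fun U x = twist (u g) (q g) x.
  move=> g; apply: (@Aut_of_ae_inverse _ _ _ _ _ (twist (u g^-1%g) (q g^-1%g))).
  - exact: measurable_twist.
  - exact: measurable_twist.
  - by move=> C mC; exact: twist_mp.
  - by apply: (filterS2 _ _ (tM g^-1%g g) t1) => x ->; rewrite mulVg.
  - by apply: (filterS2 _ _ (tM g g^-1%g) t1) => x ->; rewrite mulgV.
have BM : {morph B : g h / (g * h)%g >-> (g * h)%g}.
  move=> g h; apply: Aut_ext.
  have Bgh : \forall x \ae mu, Aut_fun (Aut_mul (B g) (B h)) x =
      twist (u g) (q g) (twist (u h) (q h) x).
    have k2 := ae_mp_preimage (repr (B h)) (BE g).
    by apply: (filterS3 _ _ (Aut_fun_mul (B g) (B h)) (BE h) k2) => x m1 m2 m3;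
      rewrite -m2 -m3 m1.
  by apply: (filterS3 _ _ Bgh (BE (g * h)%g) (tM g h)) => x -> -> ->.
pose b : actions G mu := HB.pack B (isMultiplicative.Build G (Aut mu) B BM).
by exists b.
Qed.

End Twist.

Section ProductGroups.
Context d (X : measurableType d) (R : realType) (mu : probability X R).
Variables (Gamma G H : groupType) (phi : {multiplicative (G * H)%type -> Gamma}).
Hypothesis phi_bij : bijective phi.
Hypothesis H_infinite : infinite_set [set: H].
Hypothesis H_amenable : amenable H.
Hypothesis H_rf : residually_finite H.

(** [T] is the first coordinate of the splitting. The error has three parts: [B] is replaced by
    [T^-1 B]; on the good fibres [T] intertwines [b g] with [a g], and the bad ones have mass at
    most [1 / n.+1]; finally [T] is removed from the preimage under [a g]. *)
Lemma product_approximation (f : X -> measurableTypeR R) (a : actions Gamma mu)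
    (K : seq Gamma) (n : nat) :
  measure_iso mu (unit_lebesgue R) f ->
  exists (b : actions Gamma mu) (T : X -> X),
    [/\ (forall N, exists2 W : {fset Gamma}, (N <= #|` W|)%N &
          forall w, w \in W -> \forall x \ae mu, act b w x = x),
        measurable_fun setT T /\ (forall B, measurable B -> mu (T @^-1` B) = mu B),
        (forall q : R, (mu (T @^-1` (f @^-1` `]q, +oo[) `+` f @^-1` `]q, +oo[) <=
          (2 / n.+1%:R)%:E)%E) &
        (forall g B, g \in K -> measurable B ->
          (mu (act b g @^-1` B `+` act a g @^-1` B) <=
            mu (T @^-1` B `+` B) + n.+1%:R^-1%:E +
            mu (T @^-1` (act a g @^-1` B) `+` act a g @^-1` B))%E)].
Proof.
move=> fiso; have [psi phiK psiK] := phi_bij.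
have psiM x y : psi (x * y)%g = (psi x * psi y)%g.
  by apply: (bij_inj phi_bij); rewrite gmulfM !psiK.
have psi1 : psi 1%g = 1%g.
  by apply: (@mulgI _ (psi 1%g)); rewrite -psiM !mulg1.
have [Y [y0 [p [s [pA sP]]]]] :=
  almost_equivariant_map [seq (psi g).2 | g <- K] n.+1 H_amenable H_rf.
have [T [kappa [sigma [S Tnear]]]] := lebesgue_splitting y0 n fiso.
pose c g y : Gamma := phi ((psi g).1, (s (p (psi g).2 y) * (s y)^-1)%g).
pose q g := p (psi g).2.
pose u g y := aut_of a (c g y).
have phi1 : phi (1, 1)%g = 1%g by have := psiK 1%g; rewrite psi1.
have qA : is_action q.
  split; first by move=> y; rewrite /q psi1; exact: pA.1.
  by move=> g h y; rewrite /q psiM; exact: pA.2.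
have aut1 : aut_of a 1%g = Aut_one mu by exact: action1.
have c1 g y : psi g = (1%g, (psi g).2) -> q g y = y -> c g y = 1%g.
  by move=> g1 qgy; rewrite /c -/(q g y) qgy mulgV g1.
have cM g h y : c (g * h)%g y = (c g (q h y) * c h y)%g.
  rewrite /c /q -gmulfM psiM /=; congr (phi (_, _)).
  by rewrite /= pA.2 mulgA mulgVK.
have u1 y : u 1%g y = Aut_one mu.
  by rewrite /u c1 ?psi1//; exact: qA.1.
have uM g h y : u (g * h)%g y = Aut_mul (u g (q h y)) (u h y).
  by rewrite /u cM; exact: gmulfM.
have [b bE] := cocycle_action S qA u1 uM.
have mT B : measurable B -> measurable (T @^-1` B).
  by move=> mB; rewrite -[_ @^-1` _]setTI; exact: (split_mA S).
exists b, T; split=> //.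
- move=> N.
  have qfin : finite_set (range (fun h : H => [ffun y => p h y])).
    by apply: (@sub_finite_set _ _ [set: {ffun Y -> Y}]) => //; exact: finite_finset.
  (* Each [h] in [W] satisfies [p (h0 * h) = p h0], hence acts trivially on [Y]. *)
  have [h0 [W [NW Wh]]] := infinite_repetition N H_infinite qfin.
  exists [fset phi (1%g, h) | h in W]%fset.
    rewrite card_imfset//= => h h' /(bij_inj phi_bij)[]; exact.
  move=> _ /imfsetP[h /= hW ->]; set w := phi _.
  have psiw : psi w = (1%g, h) by exact: phiK.
  have qw y : q w y = y.
    rewrite /q psiw /=; apply: (can_inj (is_actionVK pA h0)).
    by have /ffunP/(_ y) := Wh h hW; rewrite !ffunE pA.2.
  have h2 : \forall x \ae mu, twist T kappa sigma (u w) (q w) x = x.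
    by apply: (twist_one S) => // y; rewrite /u c1// psiw.
  by apply: (filterS2 _ _ (bE w) h2) => x -> ->.
- by split; [exact: (split_mA S)|move=> B; exact: (split_A_mp S)].
move=> g B gK mB; set C := act a g @^-1` B.
have mC : measurable C by exact: act_preimage_measurable.
pose bad := [set y | s (p (psi g).2 y) != ((psi g).2 * s y)%g]%SET.
have mbT : measurable (act b g @^-1` (T @^-1` B)).
  by apply: act_preimage_measurable; exact: mT.
have mbB : measurable (act b g @^-1` B) by exact: act_preimage_measurable.
have mbad : measurable (kappa @^-1` [set y | y \in enum bad]).
  by apply: measurable_label_set => y; exact: (split_mkappa S).
apply: le_trans (measureY_triangle mu mbB (mT _ mC) mC) _.
rewrite leeD2r//; apply: le_trans (measureY_triangle mu mbB mbT (mT _ mC)) _.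
have -> : act b g @^-1` B `+` act b g @^-1` (T @^-1` B) = act b g @^-1` (B `+` T @^-1` B) by [].
rewrite act_mp; last by apply: measurableY => //; exact: mT.
rewrite setYC leeD2l//.
apply: (@le_trans _ _ (mu (kappa @^-1` [set y | y \in enum bad]))); last first.
  apply: le_trans (mu_kappa_le S _) _; rewrite lee_fin.
  have Y0 : (0 < #|Y|)%N by apply/card_gt0P; exists y0.
  rewrite ler_pdivrMr ?ltr0n// mulrC ler_pdivlMr ?ltr0n// -natrM ler_nat mulnC -cardE.
  by apply: sP; apply/mapP; exists g.
have mD : measurable (act b g @^-1` (T @^-1` B) `+` T @^-1` C).
  by apply: measurableY => //; exact: mT.
have h3 : \forall x \ae mu, T (act b g x) = Aut_fun (u g (kappa x)) (T x).
  by apply: (filterS2 _ _ (bE g) (split_A_twist S (u g) (q g))) => x ->.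
(* On these fibres [s (p (psi g).2 y) * (s y)^-1] is just the [H]-component of [g]. *)
have good y : y \notin bad -> u g y = aut_of a g.
  rewrite inE negbK => /eqP sy; rewrite /u /c sy mulgK.
  by have -> : phi ((psi g).1, (psi g).2) = g by rewrite -surjective_pairing psiK.
rewrite -(@ae_measure_eq _ _ _ mu ((act b g @^-1` (T @^-1` B) `+` T @^-1` C) `&`
  kappa @^-1` [set y | y \in enum bad])).
- by apply: le_measure; rewrite ?inE//; exact: measurableI.
- exact: measurableI.
- exact: mD.
apply: filterS h3 => x Tx; split=> [[]//|Dx]; split => //=; rewrite mem_enum.
apply: contraT => /good ux; move: Dx; rewrite /setY /= Tx ux.
by move=> [[]|[]].
Qed.

End ProductGroups.

(** * Density and conclusion *)

Section Density.
Context d (X : measurableType d) (R : realType) (mu : probability X R).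
Variable Gamma : groupType.
Hypothesis Gamma_countable : countable [set: Gamma].

Lemma product_recurrence_dense (G H : groupType)
    (phi : {multiplicative (G * H)%type -> Gamma}) (C : nat -> set X) :
  lebesgue_space mu -> (forall i, measurable (C i)) ->
  bijective phi -> infinite_set [set: H] -> amenable H -> residually_finite H ->
  dense (@recurrence_set Gamma _ X R mu C).
Proof.
move=> [f fiso] mC phi_bij Hinf Ham Hrf; apply: dense_actions => a.
have [e eP] := countable_enumeration 1%g Gamma_countable.
have /choice[bT bTP] : forall n, exists bT : actions Gamma mu * (X -> X),
    [/\ (forall N, exists2 W : {fset Gamma}, (N <= #|` W|)%N &
          forall w, w \in W -> \forall x \ae mu, act bT.1 w x = x),
        measurable_fun setT bT.2 /\ (forall B, measurable B -> mu (bT.2 @^-1` B) = mu B),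
        (forall q : R, (mu (bT.2 @^-1` (f @^-1` `]q, +oo[) `+` f @^-1` `]q, +oo[) <=
          (2 / n.+1%:R)%:E)%E) &
        (forall g B, g \in map e (iota 0 n) -> measurable B ->
          (mu (act bT.1 g @^-1` B `+` act a g @^-1` B) <=
            mu (bT.2 @^-1` B `+` B) + n.+1%:R^-1%:E +
            mu (bT.2 @^-1` (act a g @^-1` B) `+` act a g @^-1` B))%E)].
  (* The [n]-th action is close to [a] on the first [n] elements of [Gamma], so the sequence
     converges at every element. *)
  move=> n; have [b [T bTP]] := product_approximation phi_bij Hinf Ham Hrf a
    (map e (iota 0 n)) n fiso.
  by exists (b, T).
exists (fun n => (bT n).1); split.
  move=> n; apply: recurrence_setP => // N; have [rec _ _ _] := bTP n.
  have [W NW WP] := rec N; exists W => // w i wW _.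
  rewrite measureY_ae0 ?lte_fin ?invr_gt0//; first exact: act_preimage_measurable.
  by apply: filterS (WP w wW) => x /= ->.
have small (e0 : R) : 0 < e0 -> \forall n \near \oo, n.+1%:R^-1 < e0.
  move=> e00; exists (Num.truncn e0^-1) => // n /= en.
  rewrite invf_plt ?posrE//; apply: lt_le_trans (truncnS_gt _) _.
  by rewrite ler_nat ltnS.
have mray i : measurable (@rational_ray R i) by exact: measurable_itv.
have [mfC appC] := approximable_iso 0%N fiso mray (@rational_ray_generates R).
have nf B : measurable B -> nearly_fixed mu \oo (fun n => (bT n).2) B.
  apply: (@nearly_fixed_approximable _ _ _ _ _ _ _ _ (fun i => f @^-1` @rational_ray R i)) => //.
  - by move=> n; have [_ []] := bTP n.
  - by move=> n; have [_ []] := bTP n.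
  move=> i e0 e00; have e20 : 0 < e0 / 2 by rewrite divr_gt0.
  apply: filterS (small _ e20) => n ne; have [_ _ nearT _] := bTP n.
  apply: le_lt_trans (nearT _) _; rewrite lte_fin.
  by rewrite mulrC -ltr_pdivlMr.
move=> g B e0 mB e00; have e30 : 0 < e0 / 3 by rewrite divr_gt0.
have [i ig] := eP g.
have mC' : measurable (act a g @^-1` B) by exact: act_preimage_measurable.
near=> n.
have [_ _ _ close] := bTP n.
have gn : g \in map e (iota 0 n).
  rewrite -ig; apply: map_f; rewrite mem_iota /= add0n.
  by near: n; exists i.+1.
apply: le_lt_trans (close g B gn mB) _.
have -> : e0 = e0 / 3 + e0 / 3 + e0 / 3 by field.
rewrite !EFinD; apply: lteD; first apply: lteD.
- by near: n; exact: nf.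
- by rewrite lte_fin; near: n; exact: small.
- by near: n; exact: nf.
Unshelve. all: by end_near. Qed.

End Density.

Theorem theorem1p3 (R : realType) (Gamma : groupType)
    (d : measure_display) (X : measurableType d) (mu : probability X R)
    (Gamma_countable : countable [set: Gamma])
    (Gamma_infinite : infinite_set [set: Gamma])
    (mu_lebesgue : lebesgue_space mu)
    (Gamma_MD_or_prod :
      property_MD Gamma mu \/
      exists (G H : groupType) (phi : {multiplicative (G * H)%type -> Gamma}),
        [/\ bijective phi, infinite_set [set: H], amenable H &
            residually_finite H]) :
  exists D : set (actions Gamma mu),
    [/\ Gdelta D, dense D & D `<=` [set a | naive_entropy a = 0%E]].
Proof.
have [C [mC appC]] := lebesgue_space_generators mu_lebesgue.
exists (recurrence_set C); split.
- exact: recurrence_set_Gdelta.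
- case: Gamma_MD_or_prod => [[eta haar cdense]|[G [H [phi [phi_bij Hinf Ham Hrf]]]]].
    (* The conjugacy class, dense by MD, is contained in the recurrence set. *)
    move=> O O0 oO; have [a [Oa aconj]] := cdense O O0 oO.
    by exists a; split => //; exact: profinite_conjugate_recurrence haar aconj.
  exact: product_recurrence_dense phi_bij Hinf Ham Hrf.
- move=> a aC; apply: recurrent_naive_entropy.
  exact: recurrence_set_recurrent aC.
Qed.
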